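(* Let $H$ be a hyperplane in $\mathbb{R}^n$ and let $1\le p<\infty$. Then the Solynin rearrangement $So_H$ with respect to $H$ is approximable in $L^p$ on $L^p_+(\mathbb{R}^n)$ by finite compositions of polarizations, and hence the associated Solynin set map is approximable on $\mathcal{L}^n$ by finite compositions of polarizations.
   Context: $\mathcal{L}^n$ is the class of Lebesgue ($\mathcal H^n$-)measurable subsets of $\mathbb{R}^n$ of finite measure; $L^p_+(\mathbb{R}^n)$ is the set of nonnegative functions in $L^p(\mathbb{R}^n)$. For an oriented hyperplane $H$ with closed halfspaces $H^+,H^-$ and reflection $x\mapsto x^\dagger$ in $H$, the polarization of a function is $P_Hf(x)=\max\{f(x),f(x^\dagger)\}$ for $x\in H^+$ and $\min\{f(x),f(x^\dagger)\}$ for $x\in H^-$; on sets, $(P_HA)\cap H^+=(A\cup A^\dagger)\cap H^+$ and $(P_HA)\cap H^-=(A\cap A^\dagger)\cap H^-$. The Solynin set map with respect to an oriented hyperplane $H$ acts separately on each line orthogonal to $H$; identifying such a line with $\mathbb{R}$ (oriented by the orientation of $H$) so that $H$ corresponds to the point $t$, it maps a measurable $A\subset\mathbb{R}$ of finite measure to $[t-r_A,t+r_A]\cup(A\cap[t,\infty))$, where $r_A\ge0$ is chosen so the measure is preserved. The Solynin rearrangement $So_H$ is the rearrangement of nonnegative functions vanishing at infinity whose superlevel sets $\{So_Hf>s\}$ are the images of $\{f>s\}$ under this set map. A map $T$ is approximable in $L^p$ on a class $X$ by maps in a family $\mathcal W$ if there are $T_k\in\mathcal W$ with $\|T_kf-Tf\|_p\to0$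 for every $f\in X$; a set map $\diamond$ is approximable on $\mathcal E$ by maps in $\mathcal G$ if there are $\diamond_k\in\mathcal G$ with $\|1_{\diamond_kA}-1_{\diamond A}\|_1\to0$ for every $A\in\mathcal E$. The polarizations in the compositions may be taken with respect to arbitrary oriented hyperplanes. *)

(* Defs.v *)
(* R^n is modelled as [n.-tuple R] with
   its canonical (Borel, product) sigma-algebra from mathcomp-analysis. *)
From HB Require Import structures.
From mathcomp Require Import all_boot all_order all_algebra.
From mathcomp Require Import all_classical all_reals all_analysis.
From mathcomp Require Import measurable_realfun.

Set Implicit Arguments.
Unset Strict Implicit.
Unset Printing Implicit Defensive.

Import Order.TTheory GRing.Theory Num.Theory.
Import numFieldNormedType.Exports.
Local Open Scope classical_set_scope.
Local Open Scope ring_scope.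

Section Defs.
Variable R : realType.

Fixpoint lebn (n : nat) : set (n.-tuple R) -> \bar R :=
  match n with
  | 0 => fun A => (\1_A [tuple] : R)%:E
  | n'.+1 => pushforward (product_measure1 (@lebesgue_measure R) (@lebn n'))
               (fun xt : R * n'.-tuple R => [tuple of xt.1 :: xt.2])
  end.

Definition outer d (T : measurableType d) (mu : set T -> \bar R) (S : set T)
  : \bar R :=
  ereal_inf [set mu B | B in [set B | measurable B /\ S `<=` B]].

(* Upper integral of a nonnegative extended-real function; for (completion-)
   measurable g it is the Lebesgue integral of g. *)
Definition upint d (T : measurableType d) (mu : set T -> \bar R)
  (g : T -> \bar R) : \bar R :=
  ereal_inf [set (\int[mu]_x h x)%E | h in
    [set h : T -> \bar R | measurable_fun setT h /\ forall x, (g x <= h x)%E]].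

(* Lebesgue measurability = measurability for the completion of lebn. *)
Definition leb_null n (N : set (n.-tuple R)) :=
  exists2 M, measurable M /\ lebn M = 0%E & N `<=` M.

Definition leb_measurable_set n (A : set (n.-tuple R)) :=
  exists2 B : set (n.-tuple R), measurable B &
    leb_null ((A `\` B) `|` (B `\` A)).

Definition leb_measurable_fun n (f : n.-tuple R -> R) :=
  exists2 g : n.-tuple R -> R, measurable_fun setT g &
    leb_null [set x | f x <> g x].

Definition Lclass n (A : set (n.-tuple R)) :=
  leb_measurable_set A /\ (outer (@lebn n) A < +oo)%E.

Definition Lp_dist_pow n (p : R) (g1 g2 : n.-tuple R -> R) : \bar R :=
  upint (@lebn n) (fun x => (`|g1 x - g2 x| `^ p)%:E).

Definition Lp_plus n (p : R) (f : n.-tuple R -> R) :=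
  (forall x, 0 <= f x) /\ leb_measurable_fun f /\
  (upint (@lebn n) (fun x => (`|f x| `^ p)%:E) < +oo)%E.

Definition dotv n (x y : n.-tuple R) : R := \sum_(i < n) tnth x i * tnth y i.

(* oriented hyperplane H = {x | <x,u> = c}, unit normal u giving the
   orientation: H^+ = {<x,u> >= c}, H^- = {<x,u> <= c}. *)
Record ohyp (n : nat) := OHyp {
  hnormal : n.-tuple R;
  hoffset : R;
  hnormal_unit : dotv hnormal hnormal = 1 }.

Definition hplus n (H : ohyp n) (x : n.-tuple R) :=
  hoffset H <= dotv x (hnormal H).
Definition hminus n (H : ohyp n) (x : n.-tuple R) :=
  dotv x (hnormal H) <= hoffset H.

Definition shiftv n (x u : n.-tuple R) (s : R) : n.-tuple R :=
  [tuple tnth x i + s * tnth u i | i < n].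

Definition hreflect n (H : ohyp n) (x : n.-tuple R) : n.-tuple R :=
  shiftv x (hnormal H) (- (2 * (dotv x (hnormal H) - hoffset H))).

Definition polar n (H : ohyp n) (f : n.-tuple R -> R) : n.-tuple R -> R :=
  fun x => if hoffset H <= dotv x (hnormal H)
           then Num.max (f x) (f (hreflect H x))
           else Num.min (f x) (f (hreflect H x)).

Definition polar_set n (H : ohyp n) (A : set (n.-tuple R)) : set (n.-tuple R) :=
  [set x | (hplus H x /\ (A x \/ A (hreflect H x))) \/
           (hminus H x /\ (A x /\ A (hreflect H x)))].

Definition polar_comp n (s : seq (ohyp n)) (f : n.-tuple R -> R) :=
  foldr (@polar n) f s.
Definition polar_set_comp n (s : seq (ohyp n)) (A : set (n.-tuple R)) :=
  foldr (@polar_set n) A s.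

Definition sol_image1 (t r : R) (B : set R) : set R :=
  `[t - r, t + r] `|` (B `&` `[t, +oo[).

Definition sol_radius (t : R) (B : set R) : R :=
  inf [set r | 0 <= r /\
     outer (@lebesgue_measure R) (sol_image1 t r B) =
     outer (@lebesgue_measure R) B].

Definition sol_set1 (t : R) (B : set R) : set R :=
  sol_image1 t (sol_radius t B) B.

(* the line orthogonal to H through x, parametrised by sigma = <y, u> *)
Definition line_section n (H : ohyp n) (A : set (n.-tuple R)) (x : n.-tuple R)
  : set R :=
  [set sig | A (shiftv x (hnormal H) (sig - dotv x (hnormal H)))].

Definition sol_set n (H : ohyp n) (A : set (n.-tuple R)) : set (n.-tuple R) :=
  [set x | sol_set1 (hoffset H) (line_section H A x) (dotv x (hnormal H))].

(* Solynin rearrangement, by the layer-cake principle: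
   So_H f (x) = sup {s > 0 | x in Sol_H {f > s}}  (0 if no such s) *)
Definition solynin n (H : ohyp n) (f : n.-tuple R -> R) : n.-tuple R -> R :=
  fun x => sup [set s | 0 < s /\ sol_set H [set y | s < f y] x].

End Defs.

(* Main.v *)
Require Import Defs.
From HB Require Import structures.
From mathcomp Require Import all_boot all_order all_algebra.
From mathcomp Require Import all_classical all_reals all_analysis.
From mathcomp Require Import measurable_realfun.
From mathcomp Require Import ring lra zify.
Import Order.TTheory GRing.Theory Num.Theory.
Import numFieldNormedType.Exports.
Local Open Scope classical_set_scope.
Local Open Scope ring_scope.

Set Implicit Arguments.
Unset Strict Implicit.
Unset Printing Implicit Defensive.

(* The approximating compositions use only hyperplanes parallel to H: they sweep
   a hyperplane in small steps from far in H^- up to H.  On a line orthogonal to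
   H and for a union of cells of the grid of the sweep, the part already swept is,
   up to one cell, an interval symmetric about the current centre, together with
   the untouched part of the set ahead of it; when the centre reaches H this is
   the Solynin set up to two cells.  Both maps are monotone and preserve measure,
   so they contract the symmetric difference, and outer regularity extends the
   convergence to all sets of finite measure on the line.  The layer-cake formula
   and dominated convergence over the lines and the levels give the case p = 1
   for functions on R^n, to which p > 1 reduces by
   |a - b|^p <= |a^p - b^p| (a, b >= 0).  Fubini in coordinates adapted to the
   normal of H replaces any use of rotation invariance. *)

(** Approximability asks for one sequence of compositions serving every function, so the centres are
    fixed in advance. Contraction then leaves only test sets to check, and these may change with the
    step. A reflection centred at an endpoint or a midpoint of a cell permutes the cells up to
    endpoints; this makes polarization an operation on sets of integers and dictates the advance by
    half a cell. The obstacle is that functions are only Lebesgue measurable, while the Solynin map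
    is given on every single line through an outer measure, an infimum and a supremum. These match
    their Borel counterparts only off null sets: points where a Borel representative differs, lines
    on which the function is not integrable or the exceptional set is not null, and H itself, where
    empty level sets still contribute a point. All of these are absorbed by the upper integral. For
    functions, the subgraph of the [p]-th power is viewed as a family of sets on lines, indexed by
    the pair of line and level, so that the convergence for sets applies to it directly. *)

(** * Symmetric differences and monotone measure-preserving set maps *)

Section symmetric_difference.
Local Open Scope ereal_scope.
Context d (T : measurableType d) (R : realType).
Variable mu : {measure set T -> \bar R}.
Implicit Types A B C : set T.

Definition symd A B := (A `\` B) `|` (B `\` A).

Lemma measurable_symd A B : measurable A -> measurable B ->
  measurable (symd A B).
Proof. by move=> mA mB; apply: measurableU; exact: measurableD. Qed.

Lemma symdC A B : symd A B = symd B A.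
Proof. by rewrite /symd setUC. Qed.

Lemma le_mu A B : measurable A -> measurable B -> A `<=` B -> mu A <= mu B.
Proof. by move=> mA mB AB; apply: le_measure => //; rewrite inE. Qed.

Lemma mu_leU A B : measurable A -> measurable B -> mu (A `|` B) <= mu A + mu B.
Proof. by move=> mA mB; exact: measureU2. Qed.

Lemma mu_symd_triangle B A C : measurable A -> measurable B -> measurable C ->
  mu (symd A C) <= mu (symd A B) + mu (symd B C).
Proof.
move=> mA mB mC.
have mAB := measurable_symd mA mB; have mBC := measurable_symd mB mC.
apply: (le_trans _ (measureU2 _ mAB mBC)).
apply: le_mu; [exact: measurable_symd|exact: measurableU|].
move=> x [[Ax nCx]|[Cx nAx]]; have [Bx|nBx] := pselect (B x).
- by right; left.
- by left; left.
- by left; right.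
- by right; right.
Qed.

Lemma mu_symdE A B : measurable A -> measurable B ->
  mu (symd A B) = mu (A `\` B) + mu (B `\` A).
Proof.
move=> mA mB; rewrite measureU//; try exact: measurableD.
by rewrite -subset0 => x [[? ?] []].
Qed.

Lemma mu_symd_le A B : measurable A -> measurable B ->
  mu (symd A B) <= mu A + mu B.
Proof.
move=> mA mB; rewrite mu_symdE//.
apply: leeD; apply: le_mu => //; try exact: measurableD; exact: subDsetl.
Qed.

Lemma mu_subD A B : measurable A -> measurable B -> A `<=` B -> mu B < +oo ->
  mu (B `\` A) = mu B - mu A.
Proof. by move=> mA mB AB Boo; rewrite measureD// setIidr. Qed.

(** [F (A & B)], with [A & B] the intersection, lies in both [F A] and [F B]. So [F A] minus [F B]
    lies in [F A] minus [F (A & B)], whose measure is [mu A - mu (A & B)], that of [A] minus [B]. *)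
Lemma mu_symd_contraction (F : set T -> set T) :
  (forall A, measurable A -> measurable (F A)) ->
  (forall A B, measurable A -> measurable B -> mu B < +oo -> A `<=` B ->
     F A `<=` F B) ->
  (forall A, measurable A -> mu A < +oo -> mu (F A) = mu A) ->
  forall A B, measurable A -> measurable B -> mu A < +oo -> mu B < +oo ->
  mu (symd (F A) (F B)) <= mu (symd A B).
Proof.
move=> mF monF muF A B mA mB Aoo Boo.
have mI : measurable (A `&` B) by exact: measurableI.
have Ioo : mu (A `&` B) < +oo.
  by apply: le_lt_trans Aoo; exact: measureIl.
have FIA : F (A `&` B) `<=` F A by apply: monF => //; exact: subIsetl.
have FIB : F (A `&` B) `<=` F B by apply: monF => //; exact: subIsetr.
have mFI := mF _ mI; have mFA := mF _ mA; have mFB := mF _ mB.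
rewrite mu_symdE// mu_symdE//.
have -> : A `\` B = A `\` (A `&` B) by rewrite setDIr setDv set0U.
have -> : B `\` A = B `\` (A `&` B) by rewrite setDIr setDv setU0.
apply: leeD.
  apply: (@le_trans _ _ (mu (F A `\` F (A `&` B)))).
    apply: le_mu; [exact: measurableD..|].
    by move=> x [Fx nFx]; split => // /FIB.
  rewrite mu_subD// ?muF// mu_subD//; exact: subIsetl.
apply: (@le_trans _ _ (mu (F B `\` F (A `&` B)))).
  apply: le_mu; [exact: measurableD..|].
  by move=> x [Fx nFx]; split => // /FIA.
rewrite mu_subD// ?muF// mu_subD//; exact: subIsetr.
Qed.

End symmetric_difference.

(** The existential hides the bundled image measure behind an equation on sets. *)
Lemma ex_pushforward d1 d2 (T1 : measurableType d1) (T2 : measurableType d2)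
    (R : realType) (m : {measure set T1 -> \bar R}) (f : T1 -> T2) :
  measurable_fun setT f ->
  exists m' : {measure set T2 -> \bar R}, forall A, m' A = m (f @^-1` A).
Proof.
by move=> mf;
  exists (measure_function_pushforward__canonical__measure_function_Measure m mf).
Qed.

(** * Polarization on the line *)

Section line.
Context {R : realType}.
Notation mu := (@lebesgue_measure R).
Implicit Types (t a b r : R) (A B C : set R).

(** By uniqueness: [|a|] times the image of Lebesgue measure gives each []x, y]] its length; for
    [a < 0] the preimage is closed at the other end. Reflections, translations and the shear of the
    line coordinates all rest on it. *)
Lemma lebesgue_measure_affine a b B : a != 0 -> measurable B ->
  mu ((fun x => a * x + b) @^-1` B) = (`|a|^-1%:E * mu B)%E.
Proof.
move=> a0 mB.
pose phi : R -> measurableTypeR R := fun x => a * x + b.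
have mphi : measurable_fun setT phi.
  by apply: measurable_funD => //; exact: mulrl_measurable.
have [m0 m0E] := ex_pushforward mu mphi.
have ap : 0 <= `|a| by [].
pose m := mscale (NngNum ap) m0.
have -> : mu (phi @^-1` B) = (`|a|^-1%:E * m B)%E.
  by rewrite /m /mscale/= m0E muleA -EFinM mulVf ?normr_eq0// mul1e.
congr (_ * _)%E; apply/esym; apply: lebesgue_measure_unique => //.
move=> _ [[x y] _ <-] /=.
rewrite /m /mscale/= m0E lebesgue_measure_itv/= lte_fin.
have [a1|a1|a1] := ltgtP a 0; last by rewrite a1 eqxx in a0.
  have -> : phi @^-1` `]x, y]%classic = `[(y - b) / a, (x - b) / a[%classic.
    apply/seteqP; split => z /=; rewrite !in_itv/= /phi.
      by rewrite ler_ndivrMr// ltr_ndivlMr//; lra.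
    by rewrite ler_ndivrMr// ltr_ndivlMr//; lra.
  rewrite lebesgue_measure_itv/= lte_fin ltr_nM2r ?invr_lt0// ltrD2r.
  case: ifPn => _; last by rewrite mule0.
  by rewrite -!EFinB -EFinM ltr0_norm//; congr EFin; field.
have -> : phi @^-1` `]x, y]%classic = `](x - b) / a, (y - b) / a]%classic.
  apply/seteqP; split => z /=; rewrite !in_itv/= /phi.
    by rewrite ltr_pdivrMr// ler_pdivlMr//; lra.
  by rewrite ltr_pdivrMr// ler_pdivlMr//; lra.
rewrite lebesgue_measure_itv/= lte_fin ltr_pM2r ?invr_gt0// ltrD2r.
case: ifPn => _; last by rewrite mule0.
by rewrite -!EFinB -EFinM gtr0_norm//; congr EFin; field.
Qed.

Definition polar1 a B : set R :=
  [set x | (a <= x /\ (B x \/ B (2 * a - x))) \/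
           (x <= a /\ (B x /\ B (2 * a - x)))].

Definition reflect1 a B : set R := (fun x => -1 * x + 2 * a) @^-1` B.

Lemma measurable_reflect1 a B : measurable B -> measurable (reflect1 a B).
Proof.
move=> mB; rewrite /reflect1 -[X in measurable X]setTI.
suff : measurable_fun setT (fun x : R => -1 * x + 2 * a) by apply.
by apply: measurable_funD => //; exact: mulrl_measurable.
Qed.

Lemma mu_reflect1 a B : measurable B -> mu (reflect1 a B) = mu B.
Proof.
by move=> mB; rewrite lebesgue_measure_affine// ?oppr_eq0// normrN1 invr1 mul1e.
Qed.

Lemma polar1E a B : polar1 a B =
  ((B `|` reflect1 a B) `&` `[a, +oo[) `|` ((B `&` reflect1 a B) `&` `]-oo, a]).
Proof.
have e x : 2 * a - x = -1 * x + 2 * a by ring.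
apply/seteqP; split => x; rewrite /polar1 /reflect1 /= !in_itv/= andbT e; tauto.
Qed.

Lemma measurable_polar1 a B : measurable B -> measurable (polar1 a B).
Proof.
move=> mB; rewrite polar1E; have mr := measurable_reflect1 a mB.
by apply: measurableU; apply: measurableI => //;
  [exact: measurableU|exact: measurableI].
Qed.

Lemma polar1_mono a A B : A `<=` B -> polar1 a A `<=` polar1 a B.
Proof.
move=> AB x [[ax H]|[xa [/AB ? /AB ?]]]; last by right.
by left; split => //; case: H => /AB ?; [left|right].
Qed.

(* Adding the measures of [polar1 a B] and of its mirror image gives the sum over
   their union and intersection, which are those of [B] and its mirror image. *)
Lemma mu_polar1 a B : measurable B -> (mu B < +oo)%E -> mu (polar1 a B) = mu B.
Proof.
move=> mB Boo.
have mr := measurable_reflect1 a mB; have mP := measurable_polar1 a mB.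
have mrP := measurable_reflect1 a mP.
have e x : 2 * a - x = -1 * x + 2 * a by ring.
have e2 x : -1 * (-1 * x + 2 * a) + 2 * a = x by ring.
have PU : polar1 a B `|` reflect1 a (polar1 a B) = B `|` reflect1 a B.
  apply/seteqP; split => x; rewrite /polar1 /reflect1 /= !e !e2; first by tauto.
  have [ax|ax] := orP (le_total a x).
    by move=> H; left; left; tauto.
  move=> H; right; left; split; [lra|tauto].
have PI : polar1 a B `&` reflect1 a (polar1 a B) = B `&` reflect1 a B.
  apply/seteqP; split => x; rewrite /polar1 /reflect1 /= !e !e2; last first.
    have [ax|ax] := orP (le_total a x) => H.
      split; first tauto.
      by right; split; [lra|tauto].
    split; first by right; split; [lra|tauto].
    by left; split; [lra|tauto].
  move=> [[[ax H]|[xa H]]]; last tauto.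
  move=> [[ax' H']|[xa' H']]; last tauto.
  have xa : x = a by lra.
  have ex : -1 * x + 2 * a = x by lra.
  by move: H H'; rewrite ex; tauto.
have Poo : (mu (polar1 a B) < +oo)%E.
  apply: (@le_lt_trans _ _ (mu (B `|` reflect1 a B))).
    apply: le_mu => //; [exact: measurableU|].
    by rewrite -PU; exact: subsetUl.
  have H0 : (mu (B `|` reflect1 a B) <= mu B + mu (reflect1 a B))%E by exact: mu_leU.
  apply: (le_lt_trans H0).
  by rewrite mu_reflect1// lte_add_pinfty.
have H1 : mu (polar1 a B `|` reflect1 a (polar1 a B)) = (mu (polar1 a B) +
    mu (reflect1 a (polar1 a B)) - mu (polar1 a B `&` reflect1 a (polar1 a B)))%E.
  exact: measureUfinl.
have H2 : mu (B `|` reflect1 a B) =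
    (mu B + mu (reflect1 a B) - mu (B `&` reflect1 a B))%E by exact: measureUfinl.
rewrite PU PI H2 !mu_reflect1// in H1.
have Ioo : (mu (B `&` reflect1 a B) \is a fin_num)%E.
  by rewrite ge0_fin_numE//; apply: le_lt_trans Boo; exact: measureIl.
move: H1.
have Bf : mu B \is a fin_num by rewrite ge0_fin_numE.
have Pf : mu (polar1 a B) \is a fin_num by rewrite ge0_fin_numE.
rewrite -(fineK Ioo) -(fineK Bf) -(fineK Pf) -!EFinD => -[H].
by congr EFin; lra.
Qed.

Definition sweep1 (s : seq R) B := foldr polar1 B s.

Lemma measurable_sweep1 s B : measurable B -> measurable (sweep1 s B).
Proof. by move=> mB; elim: s => //= a s IH; exact: measurable_polar1. Qed.

Lemma sweep1_mono s A B : A `<=` B -> sweep1 s A `<=` sweep1 s B.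
Proof. by move=> AB; elim: s => //= a s IH; exact: polar1_mono. Qed.

Lemma mu_sweep1 s B : measurable B -> (mu B < +oo)%E -> mu (sweep1 s B) = mu B.
Proof.
move=> mB Boo; elim: s => //= a s IH.
by rewrite mu_polar1// ?IH//; exact: measurable_sweep1.
Qed.

End line.

(** * The sweep of a set of integers *)

Section discrete.
Implicit Types (c : set int) (m j l h : int).

(** Polarization at the centre [t + m * delta / 2], read on cell indices: the reflection exchanges
    the cells [j] and [m - 1 - j]. *)
Definition int_polar m c : set int :=
  [set j | (m - 1 - j <= j /\ (c j \/ c (m - 1 - j))) \/
           (j <= m - 1 - j /\ (c j /\ c (m - 1 - j)))].

(** Invariant of the sweep, [c0] being the initial and [c] the current set: [[l, h]] is the
    symmetric block, and [h + 1] is the one cell that may have been filled on the way. As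
    [l + h = m - 1] fixes the parity of the number of cells, an empty block alternates between
    [l = h + 1] and [l = h + 2]; hence the bound [l <= h + 2]. *)
Definition swept m c c0 := exists l h,
  [/\ l + h = m - 1, l <= h + 2 & (forall j, j < l -> ~ c j)] /\
  [/\ (forall j, l <= j <= h -> c j), (forall j, h + 1 < j -> (c j <-> c0 j)) &
      (c0 (h + 1) -> c (h + 1))].

(** At the new centre the trailing cell [l] faces [h + 1]. If [h + 1] is occupied, the block absorbs
    it; if not, polarization carries [l] over to [h + 1], where the next step absorbs it. *)
Lemma swept_int_polar m c c0 : swept m c c0 -> swept (m + 1) (int_polar (m + 1) c) c0.
Proof.
move=> [l [h [[lh lh2 c0l] [clh chr ch1]]]].
have mE j : m + 1 - 1 - j = l + h + 1 - j by lia.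
(* The block of length [-1] goes with the first case: raising [h] by one makes it an ordinary empty
   block. *)
have [/orP H|/norP[/asboolPn nch lneq]] := boolP (`[< c (h + 1) >] || (l == h + 2)).
- have clh' j : l <= j <= h + 1 -> c j.
    move=> /andP[lj jh].
    have [jh1|jh1] := leP j h; first by apply: clh; lia.
    have -> : j = h + 1 by lia.
    by case: H => [/asboolP//|/eqP]; lia.
  exists l, (h + 1); split; split; try lia.
  + move=> j jl; rewrite /int_polar/= mE => -[[? _]|[_ [cj _]]]; first lia.
    exact: (c0l j).
  + move=> j /andP[lj jh]; rewrite /int_polar/= mE.
    have c1 : c j by apply: clh'; lia.
    have c2 : c (l + h + 1 - j) by apply: clh'; lia.
    by have [?|?] := orP (le_total (l + h + 1 - j) j); [left|right]; tauto.
  + move=> j hj; rewrite /int_polar/= mE -chr; last lia.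
    have c2 : ~ c (l + h + 1 - j) by apply: c0l; lia.
    split => [|cj]; first tauto.
    by left; split; [lia|left].
  + move=> /chr ch2; rewrite /int_polar/= mE; left; split; first lia.
    by left; apply: ch2; lia.
- have {}lneq : l <> h + 2 by apply/eqP.
  exists (l + 1), h; split; split; try lia.
  + move=> j jl; rewrite /int_polar/= mE.
    have [jl'|jl'] := ltP j l.
      by move=> [[? _]|[_ [cj _]]]; [lia|exact: (c0l j)].
    have -> : l + h + 1 - j = h + 1 by lia.
    move=> [[hj [cj|//]]|[_ [_ //]]].
    by apply: nch; have <- : j = h + 1 by lia.
  + move=> j /andP[lj jh]; rewrite /int_polar/= mE.
    have c1 : c j by apply: clh; lia.
    have c2 : c (l + h + 1 - j) by apply: clh; lia.
    by have [?|?] := orP (le_total (l + h + 1 - j) j); [left|right]; tauto.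
  + move=> j hj; rewrite /int_polar/= mE -chr; last lia.
    have c2 : ~ c (l + h + 1 - j) by apply: c0l; lia.
    split => [|cj]; first tauto.
    by left; split; [lia|left].
  + by move=> /ch1.
Qed.

Lemma swept_start (N : nat) c :
  (forall j, j < - N%:Z -> ~ c j) -> swept (- (2 * N)%:Z) c c.
Proof.
move=> cN; exists (- N%:Z), (- N%:Z - 1); split; split => //; try lia.
Qed.

(** [foldr] applies the last index first, so the centre rises from [-(a + n - 1)] to [-a]. *)
Definition int_sweep a n c := foldr (fun j : nat => int_polar (- j%:Z)) c (iota a n).

Lemma swept_int_sweep a n N c : (a + n = 2 * N)%N ->
  (forall j, j < - N%:Z -> ~ c j) -> swept (- a%:Z) (int_sweep a n c) c.
Proof.
move=> + cN; elim: n a => [|n IH] a anN.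
  by rewrite addn0 in anN; rewrite anN; exact: swept_start.
rewrite /int_sweep/=.
have -> : - a%:Z = - a.+1%:Z + 1 by lia.
by apply: swept_int_polar; apply: IH; lia.
Qed.

(** The invariant at [m = 0], with the centre on H: symmetry gives [l = -(h + 1)], and [h = -1] is
    the empty block. *)
Lemma int_sweep_end N c : (forall j, j < - N%:Z -> ~ c j) ->
  exists h, let c' := int_sweep 0 (2 * N) c in
  [/\ -1 <= h, (forall j, j < - (h + 1) -> ~ c' j),
      (forall j, - (h + 1) <= j <= h -> c' j),
      (forall j, h + 1 < j -> (c' j <-> c j)) & (c (h + 1) -> c' (h + 1))].
Proof.
move=> cN; have [l [h [[lh lh2 c0l] [clh chr ch1]]]] :=
  @swept_int_sweep 0 (2 * N) N c erefl cN.
have lE : l = - (h + 1) by lia.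
by subst l; exists h; split => //; lia.
Qed.

End discrete.

(** * The Solynin set map on the line *)

Section solynin_line.
Context {R : realType}.
Notation mu := (@lebesgue_measure R).
Implicit Types (t a b r : R) (A B C : set R).

Lemma sol_image1_mono t r r' A B : r <= r' -> A `<=` B ->
  sol_image1 t r A `<=` sol_image1 t r' B.
Proof.
move=> rr' AB x [/=|[/AB ? ?]]; last by right.
by rewrite in_itv/= => ?; left; rewrite /= in_itv/=; lra.
Qed.

Lemma measurable_sol_image1 t r B : measurable B -> measurable (sol_image1 t r B).
Proof. by move=> mB; apply: measurableU => //; exact: measurableI. Qed.

(** The Solynin set without its radius: [|s - t|] is at most the radius exactly when the image with
    radius [|s - t|] is not larger than [B]. In this form monotonicity is direct, and measurability
    in a parameter needs no measurable choice of radius. *)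
Definition solynin_set1 t B : set R :=
  [set s | (t <= s /\ B s) \/ (mu (sol_image1 t `|s - t|%R B) <= mu B)%E].

Lemma mu_sol_image1_ltoo t r B : measurable B -> (mu B < +oo)%E ->
  (mu (sol_image1 t r B) < +oo)%E.
Proof.
move=> mB Boo.
have H : (mu (sol_image1 t r B) <= mu `[(t - r)%R, (t + r)%R]%classic + mu B)%E.
  apply: (@le_trans _ _ (mu (`[t - r, t + r]%classic `|` B))).
    apply: le_mu; [exact: measurable_sol_image1|exact: measurableU|].
    by apply: setUS; exact: subIsetl.
  exact: mu_leU.
apply: (le_lt_trans H); apply: lte_add_pinfty => //.
by rewrite lebesgue_measure_itv/=; case: ifP => // _; rewrite -EFinB ltry.
Qed.

(** The interval grows at both ends, whence the factor 2. This supplies the continuity in [r] needed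
    for the existence of the radius. *)
Lemma mu_sol_image1_lip t r r' B : measurable B -> 0 <= r <= r' ->
  (mu (sol_image1 t r' B) <= mu (sol_image1 t r B) + (2 * (r' - r))%:E)%E.
Proof.
move=> mB /andP[r0 rr'].
pose L : set R := `[t - r', t - r]%classic; pose K : set R := `[t + r, t + r']%classic.
have mJ := measurable_sol_image1 t r mB.
have mL : measurable L by exact: measurable_itv.
have mK : measurable K by exact: measurable_itv.
apply: (@le_trans _ _ (mu (sol_image1 t r B `|` (L `|` K)))).
  apply: le_mu; [exact: measurable_sol_image1| |].
    by apply: measurableU => //; exact: measurableU.
  move=> x [/=|[Bx xt]]; last by left; right.
  rewrite in_itv/= => /andP[x1 x2].
  have [xr|xr] := ltP x (t - r).
    by right; left; rewrite /L/= in_itv/=; lra.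
  have [xr'|xr'] := ltP (t + r) x.
    by right; right; rewrite /K/= in_itv/=; lra.
  by left; left; rewrite /= in_itv/=; lra.
have H1 : (mu (sol_image1 t r B `|` (L `|` K)) <=
    mu (sol_image1 t r B) + mu (L `|` K))%E.
  by apply: mu_leU => //; exact: measurableU.
apply: (le_trans H1); apply: leeD => //.
have H2 : (mu (L `|` K) <= mu L + mu K)%E by exact: mu_leU.
apply: (le_trans H2).
have -> : 2 * (r' - r) = (r' - r) + (r' - r) by ring.
rewrite /L /K EFinD !lebesgue_measure_itv/= !lte_fin.
by apply: leeD; case: ifPn => _; rewrite -?EFinB lee_fin; lra.
Qed.

(** Behind [t] the image is the interval alone, so the piece gained on the left is entirely new.
    This gives uniqueness of the radius and, from [r = 0], a bound on it. *)
Lemma mu_sol_image1_grow t r r' B : measurable B -> 0 <= r <= r' ->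
  (mu (sol_image1 t r B) + (r' - r)%:E <= mu (sol_image1 t r' B))%E.
Proof.
move=> mB /andP[r0 rr'].
pose L : set R := `[t - r', t - r[%classic.
have mL : measurable L by exact: measurable_itv.
have mJ := measurable_sol_image1 t r mB.
have -> : (r' - r)%:E = mu L.
  rewrite lebesgue_measure_itv/= lte_fin; case: ifPn => H; rewrite -?EFinB;
    congr EFin; lra.
have <- : mu (sol_image1 t r B `|` L) = (mu (sol_image1 t r B) + mu L)%E.
  apply: measureU => //; rewrite -subset0 => x [].
  by case=> [/=|[_ /=]]; rewrite /L/= !in_itv/=; lra.
apply: le_mu; [exact: measurableU|exact: measurable_sol_image1|].
move=> x [|]; first exact: sol_image1_mono.
by rewrite /L/= in_itv/= => ?; left; rewrite /= in_itv/=; lra.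
Qed.

(** An intermediate value argument: the radius is the supremum of those whose image is at most as
    large as [B]. *)
Lemma ex_sol_radius t B : measurable B -> (mu B < +oo)%E ->
  exists2 r, 0 <= r & mu (sol_image1 t r B) = mu B.
Proof.
move=> mB Boo.
have Bf : mu B \is a fin_num by rewrite ge0_fin_numE.
pose m r := fine (mu (sol_image1 t r B)).
have mE r : mu (sol_image1 t r B) = (m r)%:E.
  by rewrite fineK// ge0_fin_numE// mu_sol_image1_ltoo.
set M := fine (mu B); have ME : mu B = M%:E by rewrite fineK.
have lip r r' : 0 <= r <= r' -> m r' <= m r + 2 * (r' - r).
  by move=> rr'; have := mu_sol_image1_lip t mB rr'; rewrite !mE -EFinD lee_fin.
have grow r r' : 0 <= r <= r' -> m r + (r' - r) <= m r'.
  by move=> rr'; have := mu_sol_image1_grow t mB rr'; rewrite !mE -EFinD lee_fin.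
have m0 : m 0 <= M.
  rewrite -lee_fin -mE -ME.
  have e : mu (sol_image1 t 0 B) = mu (B `&` `[t, +oo[%classic).
    rewrite /sol_image1 subr0 addr0 set_itv1 setUC.
    apply: measureU0 => //; first exact: measurableI.
    exact: lebesgue_measure_set1.
  by rewrite e; apply: le_mu => //; exact: measurableI.
have m_ge0 r : 0 <= m r by exact: fine_ge0.
pose S := [set r | 0 <= r /\ m r <= M].
have S0 : S 0 by split.
have ubS : ubound S M.
  move=> r [r0 rM]; have := grow 0 r; rewrite lexx r0 => /(_ isT).
  by have := m_ge0 0; lra.
have supS : has_sup S by split; [exists 0|exists M].
have sup0 : 0 <= sup S by apply: sup_upper_bound.
exists (sup S) => //; rewrite mE ME; congr EFin; apply/eqP.
rewrite eq_le; apply/andP; split; rewrite leNgt; apply/negP => H.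
(* Halving the excess compensates the Lipschitz constant 2. *)
- have e0 : 0 < (m (sup S) - M) / 2 by lra.
  have [r [r0 rM] re] := sup_adherent e0 supS.
  have rs : r <= sup S by apply: sup_upper_bound.
  by have := lip r (sup S); rewrite r0 rs => /(_ isT); lra.
- have e0 : 0 < (M - m (sup S)) / 2 by lra.
  have : S (sup S + (M - m (sup S)) / 2).
    split; first lra.
    by have := lip (sup S) (sup S + (M - m (sup S)) / 2); rewrite sup0 lerDl ltW//=
      => /(_ isT); lra.
  by move=> /(sup_upper_bound supS); lra.
Qed.

Lemma solynin_set1E t B r : measurable B -> (mu B < +oo)%E -> 0 <= r ->
  mu (sol_image1 t r B) = mu B -> solynin_set1 t B = sol_image1 t r B.
Proof.
move=> mB Boo r0 rE; apply/seteqP; split=> x.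
  move=> [[tx Bx]|H]; first by right; split => //=; rewrite in_itv/= andbT.
  left; rewrite /= in_itv/=.
  suff : `|x - t| <= r by rewrite ler_distlC; lra.
  rewrite leNgt; apply/negP => rx.
  have := @mu_sol_image1_grow t r `|x - t| B mB; rewrite r0 (ltW rx) => /(_ isT).
  move=> /le_trans/(_ H); rewrite rE.
  by rewrite -[leRHS]adde0 leeD2lE ?ge0_fin_numE// lee_fin; lra.
move=> [/=|[Bx /=]]; rewrite in_itv/=; last by rewrite andbT => ?; left.
move=> xtr; right; rewrite -rE; apply: le_mu; [exact: measurable_sol_image1..|].
apply: sol_image1_mono => //.
by rewrite ler_distlC; lra.
Qed.

Lemma measurable_solynin_set1 t B : measurable B -> (mu B < +oo)%E ->
  measurable (solynin_set1 t B).
Proof.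
move=> mB Boo; have [r r0 rE] := ex_sol_radius t mB Boo.
by rewrite (solynin_set1E mB Boo r0 rE); exact: measurable_sol_image1.
Qed.

Lemma mu_solynin_set1 t B : measurable B -> (mu B < +oo)%E ->
  mu (solynin_set1 t B) = mu B.
Proof.
move=> mB Boo; have [r r0 rE] := ex_sol_radius t mB Boo.
by rewrite (solynin_set1E mB Boo r0 rE).
Qed.

(** Passing from [A] to [B] adds at most [B] minus [A] to the image at a given radius, and exactly
    this to the measure of the set, so the inequality defining membership survives. *)
Lemma solynin_set1_mono t A B : measurable A -> measurable B -> (mu B < +oo)%E ->
  A `<=` B -> solynin_set1 t A `<=` solynin_set1 t B.
Proof.
move=> mA mB Boo AB x [[tx /AB Bx]|H]; [by left|right].
have mD : measurable (B `\` A) by exact: measurableD.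
have mJ := measurable_sol_image1 t `|x - t|%R mA.
apply: (@le_trans _ _ (mu (sol_image1 t `|x - t|%R A `|` (B `\` A)))).
  apply: le_mu; [exact: measurable_sol_image1|exact: measurableU|].
  move=> y [?|[By ty]]; first by left; left.
  by have [Ay|nAy] := pselect (A y); [left; right|right].
have H1 : (mu (sol_image1 t `|x - t|%R A `|` (B `\` A)) <=
   mu (sol_image1 t `|x - t|%R A) + mu (B `\` A))%E by exact: mu_leU.
apply: (le_trans H1).
have -> : (mu B = mu A + mu (B `\` A))%E.
  rewrite -[in LHS](setDUK AB); apply: measureU => //.
  by rewrite -subset0 => z [Az []].
exact: leeD.
Qed.

End solynin_line.

(** * The sweep of a union of cells *)

Section grid_section.
Context {R : realType}.
Notation mu := (@lebesgue_measure R).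
Variables (t delta : R).
Hypothesis delta0 : 0 < delta.
Implicit Types (x : R) (A B : set R) (c : set int) (j m : int).

Lemma mu_symd_sweep1 s A B : measurable A -> measurable B ->
  (mu A < +oo)%E -> (mu B < +oo)%E ->
  (mu (symd (sweep1 s A) (sweep1 s B)) <= mu (symd A B))%E.
Proof.
apply: (mu_symd_contraction (mu := lebesgue_measure)).
- exact: measurable_sweep1.
- by move=> *; exact: sweep1_mono.
- exact: mu_sweep1.
Qed.

Lemma mu_symd_solynin_set1 A B : measurable A -> measurable B ->
  (mu A < +oo)%E -> (mu B < +oo)%E ->
  (mu (symd (solynin_set1 t A) (solynin_set1 t B)) <= mu (symd A B))%E.
Proof.
move=> mA mB Aoo Boo.
(* The value [set0] on sets of infinite measure makes the map preserve measurability everywhere, as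
   the contraction lemma requires. *)
pose F C := if (mu C < +oo)%E then solynin_set1 t C else set0.
have -> : solynin_set1 t A = F A by rewrite /F Aoo.
have -> : solynin_set1 t B = F B by rewrite /F Boo.
apply: (mu_symd_contraction (mu := lebesgue_measure)) => //.
- move=> X mX; rewrite /F; case: ifPn => // Coo; exact: measurable_solynin_set1.
- move=> X Y mX mY Yoo XY; rewrite /F Yoo; case: ifPn => _; last exact: sub0set.
  exact: solynin_set1_mono.
- by move=> X mX Xoo; rewrite /F Xoo; exact: mu_solynin_set1.
Qed.

Definition cell x : int := Num.floor ((x - t) / delta).
(** The cell endpoints. A reflection turns cells closed on the left into cells closed on the right,
    so the dictionary between points and indices holds only off this null set. *)
Definition grid : set R := [set x | exists j : int, x = t + j%:~R * delta].

Lemma cell_itv x : t + (cell x)%:~R * delta <= x < t + (cell x + 1)%:~R * delta.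
Proof.
have := floor_itv ((x - t) / delta); rewrite ler_pdivlMr// ltr_pdivrMr//.
by rewrite /cell; lra.
Qed.

Lemma cell_itv_off x : ~ grid x -> t + (cell x)%:~R * delta < x.
Proof.
move=> nx; rewrite lt_neqAle; have /andP[-> _] := cell_itv x; rewrite andbT.
by apply/eqP => xE; apply: nx; exists (cell x).
Qed.

Lemma cell_def x j : t + j%:~R * delta <= x < t + (j + 1)%:~R * delta ->
  cell x = j.
Proof.
move=> xj; apply: floor_def.
by rewrite ler_pdivlMr// ltr_pdivrMr//; lra.
Qed.

Lemma grid_refl m x : grid (2 * (t + m%:~R * delta / 2) - x) -> grid x.
Proof.
by move=> [j jE]; exists (m - j); rewrite rmorphB/=; lra.
Qed.

Lemma cell_refl m x : ~ grid x ->
  cell (2 * (t + m%:~R * delta / 2) - x) = m - 1 - cell x.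
Proof.
move=> nx; apply: cell_def.
have := cell_itv_off nx; have /andP[_] := cell_itv x.
by rewrite !(rmorphD, rmorphB)/=; lra.
Qed.

Lemma polar1_grid m B c : (forall x, ~ grid x -> (B x <-> c (cell x))) ->
  forall x, ~ grid x ->
    (polar1 (t + m%:~R * delta / 2) B x <-> int_polar m c (cell x)).
Proof.
move=> Bc x nx.
have nx' : ~ grid (2 * (t + m%:~R * delta / 2) - x) by move=> /grid_refl.
rewrite /polar1 /int_polar/= !Bc// cell_refl//.
set j := cell x.
have xl := cell_itv_off nx; have /andP[_ xr] := cell_itv x.
rewrite -/j in xl xr.
have [jm|jm|jm] := ltgtP (m - 1 - j) j.
- have ax : t + m%:~R * delta / 2 < x.
    apply: le_lt_trans xl.
    have : m%:~R * delta <= (j%:~R + j%:~R) * delta.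
      by rewrite ler_pM2r// -rmorphD ler_int; lia.
    by lra.
  rewrite (ltW ax) leNgt ax/=; intuition.
- have ax : x < t + m%:~R * delta / 2.
    apply: (lt_le_trans xr).
    have : ((j + 1)%:~R + (j + 1)%:~R) * delta <= m%:~R * delta.
      by rewrite ler_pM2r// -rmorphD ler_int; lia.
    by lra.
  rewrite (ltW ax) leNgt ax/=; intuition.
(* A cell that is its own mirror image has the centre as midpoint; on either side of it both
   conditions reduce to [c j]. *)
- rewrite jm.
  by have [H|H] := orP (le_total (t + m%:~R * delta / 2) x); rewrite H/=; intuition.
Qed.

Definition gridset c : set R := [set x | c (cell x)].

Lemma measurable_gridset c : measurable (gridset c).
Proof.
pose F j : set R := if `[< c j >] then
  `[t + j%:~R * delta, t + (j + 1)%:~R * delta[%classic else set0.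
have -> : gridset c = \bigcup_j F j.
  apply/seteqP; split => x /=.
    move=> cx; exists (cell x) => //; rewrite /F asboolT//=.
    by rewrite in_itv/=; exact: cell_itv.
  move=> [j _]; rewrite /F; case: asboolP => // cj.
  by rewrite /= in_itv/= => /cell_def xj; rewrite /gridset/= xj.
apply: countable_bigcupT_measurable => //.
by move=> j; rewrite /F; case: ifP.
Qed.

Lemma countable_grid : countable grid.
Proof.
have -> : grid = (fun j : int => t + j%:~R * delta) @` setT.
  by apply/seteqP; split => x [j]; [exists j|move=> _ <-; exists j].
apply: (card_le_trans (card_image_le _ _)); exact: countableP.
Qed.

Lemma measurable_grid : measurable grid.
Proof. by apply: countable_measurable => //; exact: countable_grid. Qed.

Lemma mu_grid : mu grid = 0%E.
Proof. exact: countable_lebesgue_measure0 countable_grid. Qed.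

Definition sweep_centers (n : nat) : seq R :=
  [seq t - i%:R * delta / 2 | i <- iota 0 n].

Lemma sweep_grid n c x : ~ grid x ->
  (sweep1 (sweep_centers n) (gridset c) x <-> int_sweep 0 n c (cell x)).
Proof.
suff H a y : ~ grid y ->
    (sweep1 [seq t - i%:R * delta / 2 | i <- iota a n] (gridset c) y <->
     int_sweep a n c (cell y)) by exact: H.
rewrite /int_sweep; elim: n a y => [//|n IH] a {}x nx.
rewrite /= -/(sweep1 _ _).
have -> : t - a%:R * delta / 2 = t + (- a%:Z)%:~R * delta / 2.
  by rewrite rmorphN/= -pmulrn; ring.
apply: polar1_grid => // y ny; exact: IH.
Qed.

(* Up to at most one cell, the sweep of a union of cells is the set
   [sol_image1 t r] for some [r], and so it is close to the Solynin set. *)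
Lemma mu_symd_sweep_grid (N : nat) c : (forall j, j < - N%:Z -> ~ c j) ->
  (mu (gridset c) < +oo)%E ->
  (mu (symd (sweep1 (sweep_centers (2 * N)) (gridset c)) (solynin_set1 t (gridset c)))
     <= (2 * delta)%:E)%E.
Proof.
move=> cN Goo; set G := gridset c; set D := sweep1 _ G.
have [h [h1 dl dm dr dh]] := int_sweep_end cN.
have mG : measurable G by exact: measurable_gridset.
have mD : measurable D by exact: measurable_sweep1.
have DE x : ~ grid x -> (D x <-> int_sweep 0 (2 * N) c (cell x)).
  exact: sweep_grid.
set d := int_sweep 0 (2 * N) c in dl dm dr dh DE.
(* Half the length of the final block of cells [-(h + 1), ..., h]; the interval [K] below is the
   closure of the undecided cell [h + 1]. *)
pose r : R := (h + 1)%:~R * delta.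
have r0 : 0 <= r by rewrite mulr_ge0 ?(ltW delta0)// ler0z; lia.
set J := sol_image1 t r G.
have mJ : measurable J by exact: measurable_sol_image1.
pose K : set R := `[t + r, t + r + delta]%classic.
have mK : measurable K by exact: measurable_itv.
have muK : mu K = delta%:E.
  rewrite lebesgue_measure_itv/= lte_fin ltrDl delta0 -EFinB; congr EFin; ring.
pose E2 : set R := [set t - r; t + r].
have mZ : measurable (grid `|` E2).
  by apply: measurableU; [exact: measurable_grid|exact: measurableU].
have muZ : mu (grid `|` E2) = 0%E.
  apply: null_set_setU; [exact: measurable_grid|exact: measurableU|
    exact: mu_grid|].
  apply: countable_lebesgue_measure0; apply: finite_set_countable.
  by rewrite /E2 finite_setU; split; exact: finite_set1.
have JD : J `<=` D `|` (grid `|` E2).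
  move=> x Jx; have [Zx|nZx] := pselect ((grid `|` E2) x); [by right|left].
  have nx : ~ grid x by move=> ?; apply: nZx; left.
  apply/DE => //; have xl := cell_itv_off nx; have /andP[_ xr] := cell_itv x.
  set j := cell x in xl xr *.
  have key : - (h + 1) <= j -> (j <= h \/ c j) -> d j.
    move=> hj; have [jh|jh] := leP j h; first by move=> _; apply: dm; lia.
    case=> // cj; have [jh1|jh1] := leP j (h + 1).
      by have jE : j = h + 1 by [lia]; rewrite jE; apply: dh; rewrite -jE.
    by apply/dr => //; lia.
  case: Jx => [/=|[Gx /=]]; rewrite in_itv/=.
    move=> /andP[x1 x2]; apply: key.
      have : t - r < t + (j + 1)%:~R * delta by lra.
      rewrite /r ltrD2l -mulNr ltr_pM2r// -rmorphN ltr_int; lia.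
    left.
    have : t + j%:~R * delta < t + r by lra.
    rewrite /r ltrD2l ltr_pM2r// ltr_int; lia.
  rewrite andbT => tx; apply: key; last by right.
  have : t + 0%:~R * delta < t + (j + 1)%:~R * delta by rewrite mul0r; lra.
  by rewrite ltrD2l ltr_pM2r// ltr_int; lia.
have DJ : D `\` J `<=` K `|` (grid `|` E2).
  move=> x [Dx nJx]; have [Zx|nZx] := pselect ((grid `|` E2) x); [by right|left].
  have nx : ~ grid x by move=> ?; apply: nZx; left.
  move/DE : Dx => /(_ nx).
  have xl := cell_itv_off nx; have /andP[_ xr] := cell_itv x.
  set j := cell x in xl xr * => dj.
  have hj : - (h + 1) <= j by rewrite leNgt; apply/negP => /dl.
  have lx : t - r <= x.
    have : (- (h + 1))%:~R * delta <= j%:~R * delta by rewrite ler_pM2r// ler_int.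
    by rewrite rmorphN/= /r; lra.
  have [jh|jh] := leP j h.
    exfalso; apply: nJx; left; rewrite /= in_itv/= lx/=.
    have : (j + 1)%:~R * delta <= r by rewrite /r ler_pM2r// ler_int; lia.
    by lra.
  have [jh1|jh1] := leP j (h + 1).
    have jE : j = h + 1 by lia.
    by rewrite /K/= in_itv/=; move: xl xr; rewrite jE rmorphD/= -/r /r; lra.
  exfalso; apply: nJx; right; split; first by apply/dr => //; lia.
  rewrite /= in_itv/= andbT.
  have : 0%:~R * delta <= j%:~R * delta by rewrite ler_pM2r// ler_int; lia.
  by rewrite mul0r; lra.
have muDJ : (mu (D `\` J) <= delta%:E)%E.
  have : (mu (D `\` J) <= mu (K `|` (grid `|` E2)))%E.
    by apply: le_mu => //; [exact: measurableD|exact: measurableU].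
  have -> : mu (K `|` (grid `|` E2)) = mu K by apply: measureU0.
  by rewrite muK.
have muD : mu D = mu G by apply: mu_sweep1.
(* Since [J] is no larger than [G], its radius is admissible, which places [J] inside the Solynin
   set. *)
have muJ : (mu J <= mu G)%E.
  rewrite -muD; have -> : mu D = mu (D `|` (grid `|` E2)).
    by apply/esym; apply: measureU0.
  by apply: le_mu => //; exact: measurableU.
have [rG rG0 rGE] := ex_sol_radius t mG Goo.
have JS : J `<=` solynin_set1 t G.
  move=> x [/=|[Gx /=]]; rewrite in_itv/=; last by rewrite andbT; left.
  move=> xr; right; apply: le_trans muJ; apply: le_mu => //.
    exact: measurable_sol_image1.
  apply: sol_image1_mono => //; rewrite ler_distlC; lra.
set S := solynin_set1 t G in JS *.
have mS : measurable S by exact: measurable_solynin_set1.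
have muS : mu S = mu G by exact: mu_solynin_set1.
have Jf : mu J \is a fin_num by rewrite ge0_fin_numE// (le_lt_trans muJ).
(* [S] and [D] have equal measure, so what [S] has beyond [J] is bounded by what [D] has beyond
   [J]. *)
have muSJ : (mu (S `\` J) <= delta%:E)%E.
  have -> : mu (S `\` J) = (mu S - mu J)%E.
    have Soo : (mu S < +oo)%E by [rewrite muS]; exact: mu_subD.
  rewrite muS -muD leeBlDr//.
  apply: (@le_trans _ _ (mu ((D `\` J) `|` J))).
    apply: le_mu => //; first by apply: measurableU => //; exact: measurableD.
    by move=> x Dx; have [|] := pselect (J x); [right|left].
  have H : (mu ((D `\` J) `|` J) <= mu (D `\` J) + mu J)%E.
    by apply: mu_leU => //; exact: measurableD.
  by apply: (le_trans H); exact: leeD.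
have -> : mu (symd D S) = (mu (D `\` S) + mu (S `\` D))%E by exact: mu_symdE.
have -> : (2 * delta)%:E = (delta%:E + delta%:E)%E.
  by rewrite -EFinD; congr EFin; ring.
apply: leeD.
  apply: le_trans muDJ; apply: le_mu; [exact: measurableD..|].
  by move=> x [Dx nS]; split => // /JS.
apply: le_trans muSJ.
have -> : mu (S `\` J) = mu ((S `\` J) `|` (grid `|` E2)).
  by apply/esym; apply: measureU0 => //; exact: measurableD.
apply: le_mu; [exact: measurableD|by apply: measurableU => //; exact: measurableD|].
move=> x [Sx nD]; have [/JD[//|Zx]|nJ] := pselect (J x); first by right.
by left.
Qed.

End grid_section.

(** * Null sequences of nonnegative extended reals *)

Section ereal_limits.
Context {R : realType}.
Implicit Types u v : nat -> \bar R.

Lemma cvge0P u : (forall k, 0 <= u k)%E ->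
  (forall e : R, 0 < e -> \forall k \near \oo, (u k <= e%:E)%E) ->
  u @ \oo --> 0%E.
Proof.
move=> u0 H; apply/fine_cvgP; split.
  near=> k; rewrite ge0_fin_numE//.
  have uk : (u k <= 1%:E)%E by near: k; exact: H.
  by rewrite (le_lt_trans uk)// ltry.
apply/cvgrPdist_le => e e0; near=> k; rewrite sub0r normrN /=.
have uk : (u k <= e%:E)%E by near: k; exact: H.
have fk : u k \is a fin_num by rewrite ge0_fin_numE// (le_lt_trans uk)// ltry.
by rewrite ger0_norm ?fine_ge0// -lee_fin fineK.
Unshelve. all: by end_near. Qed.

Lemma cvge0_near u (e : R) : 0 < e -> u @ \oo --> 0%E ->
  \forall k \near \oo, (u k <= e%:E)%E.
Proof.
move=> e0 /fine_cvgP[ufin /cvgrPdist_le/(_ e e0) H].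
near=> k.
have fk : u k \is a fin_num by near: k.
have : `|0 - fine (u k)| <= e by near: k.
by rewrite sub0r normrN -(fineK fk) lee_fin; exact: le_trans (ler_norm _).
Unshelve. all: by end_near. Qed.

End ereal_limits.

(** * Convergence on the line *)

Section convergence_on_the_line.
Context {R : realType}.
Notation mu := (@lebesgue_measure R).
Implicit Types (t x : R) (A B U : set R) (k : nat).

Definition mesh k : R := k.+1%:R^-1.
(** [(k + 1)^2] cells of width [1 / (k + 1)] reach back a distance [k + 1] from [t], so the start
    recedes while the mesh shrinks; there are two centres per cell. *)
Definition centers t k := sweep_centers t (mesh k) (2 * k.+1 ^ 2).

Lemma mesh_gt0 k : 0 < mesh k. Proof. by rewrite invr_gt0. Qed.

(** The cells inside [U], cut off below where the sweep starts. *)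
Definition inner_cells t U k : set int :=
  [set j | - (k.+1 ^ 2)%N%:Z <= j /\ forall y, cell t (mesh k) y = j -> U y].

Definition inner_grid t U k := gridset t (mesh k) (inner_cells t U k).

Lemma inner_grid_sub t U k : inner_grid t U k `<=` U.
Proof. by move=> x [_]; exact. Qed.

Lemma near_inner_grid t U x : open U -> U x ->
  \forall k \near \oo, inner_grid t U k x.
Proof.
move=> oU Ux.
have [e /= e0 eU] : nbhs_ball x U by rewrite nbhs_ballE; exact: open_nbhs_nbhs.
near=> k.
have k1 : 0 < k.+1%:R :> R by [].
have ke : mesh k < e.
  by near: k; apply: near_infty_natSinv_lt (PosNum e0).
have kx : `|x - t| <= k%:R by near: k; exact: nbhs_infty_ger.
have d0 := mesh_gt0 k.
split.
  rewrite -/(cell _ _ _) /cell floor_ge_int ler_pdivlMr//.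
  rewrite rmorphN/= -pmulrn natrX /mesh expr2 mulNr -mulrA mulfV ?gt_eqF// mulr1.
  by move: kx; rewrite ler_norml -natr1; lra.
move=> y yx; apply: eU; rewrite /ball/=.
have := cell_itv t d0 y; have := cell_itv t d0 x; rewrite yx => H1 H2.
apply: lt_trans ke; rewrite ltr_distlC.
by move: H1 H2; rewrite rmorphD/=; lra.
Unshelve. all: by end_near. Qed.

Lemma measurable_inner_grid t U k : measurable (inner_grid t U k).
Proof. by apply: measurable_gridset; exact: mesh_gt0. Qed.

(** Each point of [U] is eventually covered, but grids of different meshes are not nested; dominated
    convergence replaces monotone continuity of the measure. *)
Lemma cvg_mu_inner_grid t U : open U -> (mu U < +oo)%E ->
  (fun k => mu (U `\` inner_grid t U k)) @ \oo --> 0%E.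
Proof.
move=> oU Uoo; have mU : measurable U := open_measurable oU.
pose f k := fun x : measurableTypeR R => (\1_(U `\` inner_grid t U k) x : R)%:E.
have mUV k : measurable (U `\` inner_grid t U k).
  by apply: measurableD => //; exact: measurable_inner_grid.
have [] := @dominated_convergence _ (measurableTypeR R) R mu setT measurableT f
  (cst 0%E) (fun x => (\1_U x)%:E).
- by move=> k; apply/measurable_EFinP; apply: measurable_indic; exact: mUV.
- exact: measurable_cst.
- apply: aeW => x _; apply: cvg_near_cst.
  have [Ux|nUx] := pselect (U x); last first.
    by near=> k; rewrite /f indicE memNset//= => -[].
  have := near_inner_grid t oU Ux; apply: filterS => k xk.
  by rewrite /f indicE memNset//= => -[].
- apply/integrableP; split.
    by apply/measurable_EFinP; exact: measurable_indic.
  under eq_integral do rewrite gee0_abs ?lee_fin//.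
  by rewrite integral_indic// setIT.
- apply: aeW => x k _; rewrite /f gee0_abs ?lee_fin// !indicE.
  have [|_] := boolP (x \in U `\` _); last by [].
  by rewrite inE => -[Ux _]; rewrite mem_set.
move=> _ _; rewrite integral_cst// mul0e; apply: cvg_trans.
apply: near_eq_cvg; near=> k.
rewrite /f/= integral_indic ?setIT //; exact: mUV.
Unshelve. all: by end_near. Qed.

(** Contraction allows replacing [A] by an open [U] and then by a union of cells [V] on both sides;
    only the comparison for [V] uses the combinatorics. *)
Lemma cvg_sweep1 t A : measurable A -> (mu A < +oo)%E ->
  (fun k => mu (symd (sweep1 (centers t k) A) (solynin_set1 t A))) @ \oo --> 0%E.
Proof.
move=> mA Aoo; apply: cvge0P => // e e0.
have e8 : 0 < e / 8 by lra.
have [U [oU AU UA]] := lebesgue_regularity_outer mA Aoo e8.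
have mU : measurable U := open_measurable oU.
have Uoo : (mu U < +oo)%E.
  rewrite -(setDUK AU).
  have H : (mu (A `|` (U `\` A)) <= mu A + mu (U `\` A))%E.
    by apply: mu_leU => //; exact: measurableD.
  by apply: (le_lt_trans H); apply: lte_add_pinfty => //; apply: lt_trans UA _;
    rewrite ltry.
have AUe : (mu (symd A U) <= (e / 8)%:E)%E.
  have -> : symd A U = U `\` A.
    by apply/seteqP; split => x; [case=> // -[/AU]|right].
  exact: ltW.
have e16 : 0 < e / 16 by lra.
have nUV := cvge0_near e8 (cvg_mu_inner_grid t oU Uoo).
near=> k.
set V := inner_grid t U k.
have VU : V `<=` U by exact: inner_grid_sub.
have mV : measurable V by exact: measurable_inner_grid.
have Voo : (mu V < +oo)%E by apply: le_lt_trans Uoo; exact: le_mu.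
have UVe : (mu (symd U V) <= (e / 8)%:E)%E.
  have -> : symd U V = U `\` V.
    by apply/seteqP; split => x; [case=> // -[/VU]|left].
  by rewrite /V; near: k; exact: nUV.
have ke : 2 * mesh k <= e / 8.
  have : mesh k < e / 16.
    by near: k; apply: near_infty_natSinv_lt (PosNum e16).
  by lra.
have H3 : (mu (symd (sweep1 (centers t k) V) (solynin_set1 t V)) <= (e / 8)%:E)%E.
  apply: (@le_trans _ _ (2 * mesh k)%:E); last by rewrite lee_fin.
  by apply: mu_symd_sweep_grid => //; [exact: mesh_gt0|move=> j + [+ _]; lia].
have mS B : measurable B -> measurable (sweep1 (centers t k) B).
  exact: measurable_sweep1.
have mA' := mS _ mA; have mU' := mS _ mU; have mV' := mS _ mV.
have mSA : measurable (solynin_set1 t A) by exact: measurable_solynin_set1.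
have mSU : measurable (solynin_set1 t U) by exact: measurable_solynin_set1.
have mSV : measurable (solynin_set1 t V) by exact: measurable_solynin_set1.
have tri X Y Z : measurable X -> measurable Y -> measurable Z ->
    (mu (symd X Z) <= mu (symd X Y) + mu (symd Y Z))%E.
  by move=> *; exact: mu_symd_triangle.
apply: (le_trans (tri _ (solynin_set1 t U) _ mA' mSU mSA)).
(* Five errors of at most [e / 8] each: [A] to [U] and [U] to [V] under either map, and the sweep
   against the Solynin set for [V]. *)
have -> : e = e / 8 + e / 8 + e / 8 + e / 8 + e / 2 by lra.
rewrite !EFinD; apply: leeD; last first.
  apply: (@le_trans _ _ (e / 8)%:E); last by rewrite lee_fin; lra.
  by apply: le_trans AUe; rewrite (symdC A); exact: mu_symd_solynin_set1.
apply: (le_trans (tri _ (solynin_set1 t V) _ mA' mSV mSU)); apply: leeD; last first.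
  by apply: le_trans UVe; rewrite (symdC U); exact: mu_symd_solynin_set1.
apply: (le_trans (tri _ _ _ mA' mV' mSV)); apply: leeD => //.
apply: (le_trans (tri _ _ _ mA' mU' mV')); apply: leeD.
  by apply: le_trans AUe; exact: mu_symd_sweep1.
by apply: le_trans UVe; exact: mu_symd_sweep1.
Unshelve. all: by end_near. Qed.

End convergence_on_the_line.

(** * Outer measure and null sets on the line *)

Section outer_almost_everywhere.
Context {R : realType}.
Notation mu := (@lebesgue_measure R).
Implicit Types (t r : R) (B C M : set R).

(** [sol_radius] takes the outer measure of arbitrary sections; this evaluates it when the section
    is Borel up to a null set. *)
Lemma outer_lebesgue B C M : measurable B -> measurable M -> mu M = 0%E ->
  (forall x, ~ M x -> (C x <-> B x)) -> outer mu C = mu B.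
Proof.
move=> mB mM M0 CB; apply/eqP; rewrite eq_le; apply/andP; split.
  apply: ge_ereal_inf; exists (mu (B `|` M)); last first.
    by have -> : mu (B `|` M) = mu B by exact: measureU0.
  exists (B `|` M) => //; split; first exact: measurableU.
  by move=> x Cx; have [|Mx] := pselect (M x); [right|left; exact/(CB _ Mx)].
apply: le_ereal_inf_tmp => _ [D [mD CD] <-].
have <- : mu (D `|` M) = mu D by exact: measureU0.
apply: le_mu => //; first exact: measurableU.
by move=> x Bx; have [|Mx] := pselect (M x); [right|left; exact/CD/(CB _ Mx)].
Qed.

(** [B] and [C] have the same admissible radii, and growth in the radius leaves only one, so the
    infimum is that radius. Ahead of [t] the images still contain [B] and [C] themselves, which may
    differ on [M]. *)
Lemma sol_set1_ae t B C M : measurable B -> (mu B < +oo)%E ->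
  measurable M -> mu M = 0%E -> (forall x, ~ M x -> (C x <-> B x)) ->
  forall x, ~ M x -> (sol_set1 t C x <-> solynin_set1 t B x).
Proof.
move=> mB Boo mM M0 CB x Mx.
have [r r0 rE] := ex_sol_radius t mB Boo.
have JE r' y : ~ M y -> (sol_image1 t r' C y <-> sol_image1 t r' B y).
  by move=> My; rewrite /sol_image1/= CB.
rewrite (solynin_set1E mB Boo r0 rE) /sol_set1.
suff -> : sol_radius t C = r by exact: JE.
rewrite /sol_radius (_ : [set _ | _] = [set r]) ?inf1//.
apply/seteqP; split => r' /=; last first.
  move=> ->; split => //.
  rewrite (outer_lebesgue mB mM M0 CB) (outer_lebesgue _ mM M0 (JE r))//.
  exact: measurable_sol_image1.
rewrite (outer_lebesgue mB mM M0 CB) (outer_lebesgue _ mM M0 (JE r'))//; last first.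
  exact: measurable_sol_image1.
move=> [r'0 r'E]; apply/eqP; rewrite eq_le; apply/andP.
have Bf : mu B \is a fin_num by rewrite ge0_fin_numE.
have H a b : 0 <= a -> mu (sol_image1 t a B) = mu B ->
    mu (sol_image1 t b B) = mu B -> b <= a.
  move=> a0 aE bE; rewrite leNgt; apply/negP => ab.
  have := @mu_sol_image1_grow _ t a b B mB; rewrite a0 (ltW ab) => /(_ isT).
  by rewrite aE bE -[leRHS]adde0 leeD2lE// lee_fin; lra.
by split; exact: H.
Qed.

End outer_almost_everywhere.

Lemma measurable_preimage d1 d2 (T1 : measurableType d1) (T2 : measurableType d2)
    (f : T1 -> T2) (A : set T2) :
  measurable_fun setT f -> measurable A -> measurable (f @^-1` A).
Proof. by move=> mf mA; rewrite -[X in measurable X]setTI; exact: mf. Qed.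

Lemma product_measure_ysection d1 d2 (T1 : measurableType d1)
    (T2 : measurableType d2) (R : realType)
    (m1 : {sigma_finite_measure set T1 -> \bar R})
    (m2 : {sigma_finite_measure set T2 -> \bar R}) A : measurable A ->
  ((m1 \x m2) A = \int[m2]_y m1 (ysection A y))%E.
Proof.
move=> mA; rewrite (@product_measure_unique _ _ _ _ _ _ _ (m1 \x^ m2)%E)//.
by move=> X Y mX mY; exact: product_measure2E.
Qed.

(** * Convergence on a family of lines *)

Section fiberwise.
Context {R : realType} d (Z : measurableType d).
Notation mu := (@lebesgue_measure R).
Notation TR := (measurableTypeR R).
Variable nu : {sigma_finite_measure set Z -> \bar R}.
Implicit Types (A : set (TR * Z)) (t : R) (s : seq R).

Definition fiber_sweep s A : set (TR * Z) := [set p | sweep1 s (ysection A p.2) p.1].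
Definition fiber_solynin t A : set (TR * Z) :=
  [set p | solynin_set1 t (ysection A p.2) p.1].

Lemma ysection_fiber_sweep s A z :
  ysection (fiber_sweep s A) z = sweep1 s (ysection A z).
Proof. by rewrite ysectionE. Qed.

Lemma ysection_fiber_solynin t A z :
  ysection (fiber_solynin t A) z = solynin_set1 t (ysection A z).
Proof. by rewrite ysectionE. Qed.

Lemma measurable_fiber_sweep s A : measurable A -> measurable (fiber_sweep s A).
Proof.
move=> mA; elim: s => [|a s IH].
  rewrite (_ : fiber_sweep [::] A = A)//; apply/seteqP.
  by split=> -[x z]; rewrite /fiber_sweep/=; [move/ysectionP|move=> ?; apply/ysectionP].
pose rho (p : TR * Z) : TR * Z := (2 * a - p.1, p.2).
have mrho : measurable_fun setT rho.
  apply: measurable_fun_pair => //.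
  by apply: measurable_funB => //.
have mge : measurable (fst @^-1` `[a, +oo[%classic : set (TR * Z)).
  by apply: measurable_preimage => //; exact: measurable_itv.
have mle : measurable (fst @^-1` `]-oo, a]%classic : set (TR * Z)).
  by apply: measurable_preimage => //; exact: measurable_itv.
have mr : measurable (rho @^-1` fiber_sweep s A) by exact: measurable_preimage.
rewrite (_ : fiber_sweep (a :: s) A =
  (fst @^-1` `[a, +oo[%classic `&` (fiber_sweep s A `|` rho @^-1` fiber_sweep s A)) `|`
  (fst @^-1` `]-oo, a]%classic `&` (fiber_sweep s A `&` rho @^-1` fiber_sweep s A))).
  by apply: measurableU; apply: measurableI => //;
    [exact: measurableU|exact: measurableI].
by apply/seteqP; split => -[x z]; rewrite /fiber_sweep /= !in_itv/= andbT.
Qed.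

Lemma measurable_fiber_solynin t A : measurable A -> measurable (fiber_solynin t A).
Proof.
move=> mA.
(* The section of [E] above [(x, z)] is the image with radius [|x - t|] of the fibre over [z], so
   its measure is a measurable function of [(x, z)]. *)
pose E : set (TR * (TR * Z)) := [set q | `|q.1 - t| <= `|q.2.1 - t|] `|`
  ((fun q => (q.1, q.2.2)) @^-1` A `&` (fst @^-1` `[t, +oo[%classic)).
have mfst : measurable_fun setT (fst : TR * (TR * Z) -> R) by [].
have mE : measurable E.
  apply: measurableU.
    pose h (q : TR * (TR * Z)) : TR := `|q.2.1 - t| - `|q.1 - t|.
    have -> : [set q : TR * (TR * Z) | `|q.1 - t| <= `|q.2.1 - t|] =
        h @^-1` `[0, +oo[%classic.
      by apply/seteqP; split => q; rewrite /h/= in_itv/= andbT subr_ge0.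
    apply: measurable_preimage; last exact: measurable_itv.
    apply: measurable_funB; apply: (@measurableT_comp _ _ _ _ _ _ (@Num.norm R R)) => //;
      apply: measurable_funB => //.
    exact: (@measurableT_comp _ _ _ _ _ _ (fst : TR * Z -> TR)).
  apply: measurableI.
    apply: measurable_preimage => //; apply: measurable_fun_pair => //.
    exact: (@measurableT_comp _ _ _ _ _ _ (snd : TR * Z -> Z)).
  by apply: measurable_preimage => //; exact: measurable_itv.
have EE p : ysection E p = sol_image1 t `|p.1 - t| (ysection A p.2).
  rewrite !ysectionE; apply/seteqP; split => x;
    rewrite /E /sol_image1/= !in_itv/= ler_distlC.
    by move=> [H|H]; [left; lra|right].
  by move=> [H|H]; [left; lra|right].
have -> : fiber_solynin t A = (A `&` (fst @^-1` `[t, +oo[%classic)) `|`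
    [set p | mu (ysection E p) <= mu (ysection A p.2)]%E.
  apply/seteqP; split => -[x z]; rewrite /fiber_solynin /solynin_set1 /= EE/= in_itv/= andbT.
    by move=> [[? /ysectionP ?]|]; [left|right].
  by move=> [[? ?]|]; [left; split => //; exact/ysectionP|right].
apply: measurableU.
  by apply: measurableI => //; apply: measurable_preimage => //;
    exact: measurable_itv.
rewrite -[X in measurable X]setTI; apply: measurable_lee => //.
  exact: (measurable_fun_ysection (@lebesgue_measure R)).
apply: (@measurableT_comp _ _ _ _ _ _ (fun z => mu (ysection A z))) => //.
exact: (measurable_fun_ysection (@lebesgue_measure R)).
Qed.

Definition gap t A k := symd (fiber_sweep (centers t k) A) (fiber_solynin t A).

Lemma measurable_gap t A k : measurable A -> measurable (gap t A k).
Proof.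
move=> mA; apply: measurable_symd; first exact: measurable_fiber_sweep.
exact: measurable_fiber_solynin.
Qed.

Lemma ysection_gap t A k z : ysection (gap t A k) z =
  symd (sweep1 (centers t k) (ysection A z)) (solynin_set1 t (ysection A z)).
Proof.
rewrite /gap /symd -ysection_fiber_sweep -ysection_fiber_solynin.
by rewrite !ysectionE.
Qed.

Lemma cvg_gap t A : measurable A -> ((mu \x nu) A < +oo)%E ->
  (fun k => (mu \x nu) (gap t A k))%E @ \oo --> 0%E.
Proof.
move=> mA Aoo.
have mgap k := measurable_gap t k mA.
pose f k z := mu (ysection (gap t A k) z).
pose g z := mu (ysection A z).
have mg : measurable_fun setT g.
  exact: (measurable_fun_ysection (@lebesgue_measure R)).
have mf k : measurable_fun setT (f k).
  exact: (measurable_fun_ysection (@lebesgue_measure R)).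
have gint : (\int[nu]_z g z < +oo)%E by rewrite -product_measure_ysection.
have ig : nu.-integrable setT g.
  apply/integrableP; split => //.
  by under eq_integral do rewrite gee0_abs//.
have gfin : {ae nu, forall z, (g z < +oo)%E}.
  have := integrable_ae measurableT ig; apply: filterS => z /(_ I).
  by rewrite ge0_fin_numE.
have mA' z : measurable (ysection A z) by exact: measurable_ysection.
(* Both maps preserve the measure [g z] of the fibre, so the fibre of the gap has measure at most
   [2 * g z]. *)
have [] := @dominated_convergence _ Z R nu setT measurableT f (cst 0%E)
    (fun z => 2%:E * g z)%E.
- exact: mf.
- exact: measurable_cst.
- apply: filterS gfin => z gz _.
  have -> : f ^~ z = fun k => mu (symd (sweep1 (centers t k) (ysection A z))
      (solynin_set1 t (ysection A z))).
    by apply/funext => k; rewrite /f ysection_gap.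
  exact: (cvg_sweep1 t (mA' z) gz).
- by apply: integrableZl.
- apply: filterS gfin => z gz k _; rewrite /f gee0_abs// ysection_gap.
  have mS := measurable_sweep1 (centers t k) (mA' z).
  have mO := measurable_solynin_set1 t (mA' z) gz.
  have H : (mu (symd (sweep1 (centers t k) (ysection A z)) (solynin_set1 t (ysection A z)))
      <= mu (sweep1 (centers t k) (ysection A z)) + mu (solynin_set1 t (ysection A z)))%E.
    exact: mu_symd_le.
  apply: (le_trans H).
  have -> : mu (sweep1 (centers t k) (ysection A z)) = g z.
    exact: (mu_sweep1 _ (mA' z) gz).
  have -> : mu (solynin_set1 t (ysection A z)) = g z.
    exact: (mu_solynin_set1 t (mA' z) gz).
  by rewrite mule_natl mule2n.
move=> _ _; rewrite integral_cst// mul0e; apply: cvg_trans.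
apply: near_eq_cvg; near=> k.
by rewrite /= product_measure_ysection.
Unshelve. all: by end_near. Qed.

End fiberwise.

(** * Sigma-finite measures: images, products, multiples *)

Section sigma_finite_packing.
Context d (T : measurableType d) (R : realType) (m : {measure set T -> \bar R}).
Hypothesis m_sigma_finite : sigma_finite setT m.

(** The proof of sigma-finiteness is an argument of the alias, so that a canonical instance can be
    attached to it. *)
Definition sigma_finite_pack of sigma_finite setT m : set T -> \bar R := m.

HB.instance Definition _ :=
  Measure.copy (sigma_finite_pack m_sigma_finite) (m : set T -> \bar R).
HB.instance Definition _ := Measure_isSigmaFinite.Build _ _ _
  (sigma_finite_pack m_sigma_finite) m_sigma_finite.

Lemma ex_sigma_finite_measure : exists m' : {sigma_finite_measure set T -> \bar R},
  (m' : set T -> \bar R) = m.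
Proof. by exists (sigma_finite_pack m_sigma_finite). Qed.

End sigma_finite_packing.

(* The sigma-finiteness instance of the library for products of sigma-finite
   measures is shadowed by the one for products of finite measures. *)
Lemma ex_sigma_finite_product d1 d2 (T1 : measurableType d1)
    (T2 : measurableType d2) (R : realType)
    (m1 : {sigma_finite_measure set T1 -> \bar R})
    (m2 : {sigma_finite_measure set T2 -> \bar R}) :
  exists m : {sigma_finite_measure set (T1 * T2)%type -> \bar R},
    (m : set (T1 * T2) -> \bar R) = (m1 \x m2)%E.
Proof.
apply: ex_sigma_finite_measure.
have /sigma_finiteP[F [FT ndF Foo]] := sigma_finiteT m1.
have /sigma_finiteP[G [GT ndG Goo]] := sigma_finiteT m2.
exists (fun k => F k `*` G k).
  apply/seteqP; split => // -[x y] _.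
  have [i _ Fx] : (\bigcup_i F i) x by rewrite -FT.
  have [j _ Gy] : (\bigcup_i G i) y by rewrite -GT.
  (* Both exhaustions increase, so the later index serves both coordinates. *)
  exists (maxn i j) => //; split => /=.
  - by move: x Fx; exact/subsetPset/ndF/leq_maxl.
  - by move: y Gy; exact/subsetPset/ndG/leq_maxr.
move=> k; have [mF Fk] := Foo k; have [mG Gk] := Goo k.
split; first exact: measurableX.
have H := product_measure1E m1 m2 mF mG.
rewrite /= in H *; rewrite H; apply: lte_mul_pinfty => //.
by rewrite ge0_fin_numE.
Qed.

Lemma ex_sigma_finite_pushforward d1 d2 (T1 : measurableType d1)
    (T2 : measurableType d2) (R : realType)
    (m : {sigma_finite_measure set T1 -> \bar R}) (f : T1 -> T2) (g : T2 -> T1) :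
  measurable_fun setT f -> measurable_fun setT g -> cancel f g ->
  exists m' : {sigma_finite_measure set T2 -> \bar R},
    (m' : set T2 -> \bar R) = pushforward m f.
Proof.
move=> mf mg fg.
have [m0 m0E] := ex_pushforward m mf.
have [m1 m1E] : exists m1 : {sigma_finite_measure set T2 -> \bar R},
    (m1 : set T2 -> \bar R) = m0.
  apply: ex_sigma_finite_measure.
  have [F FT mF] := sigma_finiteT m.
  exists (fun k => g @^-1` F k).
    by rewrite -preimage_bigcup -FT preimage_setT.
  move=> k; have [mFk Fkoo] := mF k; split.
    exact: measurable_preimage.
  rewrite m0E -comp_preimage (_ : g \o f = id)//.
  exact/funext.
by exists m1; rewrite m1E; apply/funext => A; rewrite m0E.
Qed.

Lemma ex_sigma_finite_scale d (T : measurableType d) (R : realType)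
    (m : {sigma_finite_measure set T -> \bar R}) (k : R) : 0 < k ->
  exists m' : {sigma_finite_measure set T -> \bar R},
    forall A, m' A = (k%:E * m A)%E.
Proof.
move=> k0; pose k' : {nonneg R} := NngNum (ltW k0).
have [m1 m1E] : exists m1 : {sigma_finite_measure set T -> \bar R},
    (m1 : set T -> \bar R) = mscale k' m.
  apply: ex_sigma_finite_measure.
  have [F FT mF] := sigma_finiteT m.
  exists F => // i; have [mFi Fioo] := mF i; split => //.
  by rewrite /mscale/= lte_mul_pinfty// ?lee_fin ?ltW.
by exists m1 => A; rewrite m1E.
Qed.

Section sections_of_products.
Context d1 d2 (T1 : measurableType d1) (T2 : measurableType d2) (R : realType).
Variables (m1 : {sigma_finite_measure set T1 -> \bar R})
  (m2 : {sigma_finite_measure set T2 -> \bar R}).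
Implicit Types A B : set (T1 * T2).

Lemma eq_product_xsection A B :
  (forall x, m2 (xsection A x) = m2 (xsection B x)) ->
  ((m1 \x m2) A = (m1 \x m2) B)%E.
Proof. by move=> AB; apply: eq_integral => x _ /=; rewrite AB. Qed.

Lemma eq_product_ysection A B : measurable A -> measurable B ->
  (forall y, m1 (ysection A y) = m1 (ysection B y)) ->
  ((m1 \x m2) A = (m1 \x m2) B)%E.
Proof.
move=> mA mB AB; rewrite !product_measure_ysection//.
by apply: eq_integral => x _ /=; rewrite AB.
Qed.

End sections_of_products.

(** * Tuples as iterated products *)

Section tuples.
Context {R : realType}.
Notation mu := (@lebesgue_measure R).
Notation TR := (measurableTypeR R).
Implicit Types (n : nat) (a b s : R).

Definition consp n (p : TR * n.-tuple R) : n.+1.-tuple R := [tuple of p.1 :: p.2].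
Definition tailt n (x : n.+1.-tuple R) : n.-tuple R := [tuple of behead x].
Definition unconsp n (x : n.+1.-tuple R) : TR * n.-tuple R := (thead x, tailt x).

Lemma conspK n : cancel (@consp n) (@unconsp n).
Proof.
by move=> [a x]; congr pair; apply/val_inj.
Qed.

Lemma unconspK n : cancel (@unconsp n) (@consp n).
Proof. by move=> x; rewrite /consp /unconsp/= [RHS]tuple_eta. Qed.

Lemma measurable_consp n : measurable_fun setT (@consp n).
Proof. exact: measurable_cons. Qed.

Lemma measurable_unconsp n : measurable_fun setT (@unconsp n).
Proof.
apply: measurable_fun_pair; first exact: measurable_tnth.
exact: measurable_behead.
Qed.

Lemma ex_lebn n : exists m : {sigma_finite_measure set (n.-tuple R) -> \bar R},
  (m : set _ -> \bar R) = @lebn R n.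
Proof.
elim: n => [|n [m mE]].
  by exists (\d_([tuple] : 0.-tuple R)).
have [pm pmE] := ex_sigma_finite_product (@lebesgue_measure R) m.
have [m' m'E] := ex_sigma_finite_pushforward pm (@measurable_consp n)
  (@measurable_unconsp n) (@conspK n).
by exists m'; rewrite m'E pmE mE.
Qed.

Lemma lebnS n (A : set (n.+1.-tuple R)) :
  lebn A = (mu \x @lebn R n)%E (@consp n @^-1` A).
Proof. by []. Qed.

Lemma dotv_cons n a b (x y : n.-tuple R) :
  dotv [tuple of a :: x] [tuple of b :: y] = a * b + dotv x y.
Proof.
rewrite /dotv big_ord_recl !tnth0; congr (_ + _).
by apply: eq_bigr => i _; rewrite !tnthS.
Qed.

Lemma shiftv_cons n a b s (x y : n.-tuple R) :
  shiftv [tuple of a :: x] [tuple of b :: y] s = [tuple of (a + s * b) :: shiftv x y s].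
Proof.
apply/eq_from_tnth => i; rewrite tnth_mktuple.
case: (unliftP ord0 i) => [j ->|->]; last by rewrite !tnth0.
by rewrite !tnthS tnth_mktuple.
Qed.

Lemma dotv_shiftv n (x u v : n.-tuple R) s :
  dotv (shiftv x u s) v = dotv x v + s * dotv u v.
Proof.
rewrite /dotv mulr_sumr -big_split/=; apply: eq_bigr => i _.
by rewrite tnth_mktuple; ring.
Qed.

Lemma shiftvD n (x u : n.-tuple R) s r :
  shiftv (shiftv x u s) u r = shiftv x u (s + r).
Proof. by apply/eq_from_tnth => i; rewrite !tnth_mktuple; ring. Qed.

Lemma shiftv0 n (x u : n.-tuple R) : shiftv x u 0 = x.
Proof. by apply/eq_from_tnth => i; rewrite !tnth_mktuple; ring. Qed.

Lemma measurable_dotv n (u : n.-tuple R) : measurable_fun setT (fun x => dotv x u).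
Proof.
apply: measurable_sum => i; apply: measurable_funM => //.
exact: measurable_tnth.
Qed.

Lemma measurable_shiftv d (T : measurableType d) n (f : T -> n.-tuple R)
    (g : T -> R) (u : n.-tuple R) : measurable_fun setT f ->
  measurable_fun setT g -> measurable_fun setT (fun x => shiftv (f x) u (g x)).
Proof.
move=> mf mg; apply/measurable_fun_tnthP => i.
rewrite (_ : _ \o _ = fun x => tnth (f x) i + g x * tnth u i); last first.
  by apply/funext => x /=; rewrite tnth_mktuple.
apply: measurable_funD; last exact: measurable_funM.
by apply: (@measurableT_comp _ _ _ _ _ _ (@tnth n R ^~ i)) => //;
  exact: measurable_tnth.
Qed.

End tuples.

(** * Coordinates adapted to a hyperplane *)

Section fibration.
Context {R : realType}.
Notation mu := (@lebesgue_measure R).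
Notation TR := (measurableTypeR R).
Implicit Types (n : nat) (a b s : R).

Lemma consE n (u : n.+1.-tuple R) : u = consp (thead u, tailt u).
Proof. by rewrite -[u in LHS]unconspK. Qed.

Lemma thead_consp n a (x : n.-tuple R) : thead (consp (a, x)) = a.
Proof. by []. Qed.

Lemma tailt_consp n a (x : n.-tuple R) : tailt (consp (a, x)) = x.
Proof. exact/val_inj. Qed.

Lemma shiftv_consp n a s (x : n.-tuple R) (u : n.+1.-tuple R) :
  shiftv (consp (a, x)) u s = consp (a + s * thead u, shiftv x (tailt u) s).
Proof. by rewrite [in LHS](consE u) shiftv_cons. Qed.

Lemma dotv_consp n a (x : n.-tuple R) (u : n.+1.-tuple R) :
  dotv (consp (a, x)) u = a * thead u + dotv x (tailt u).
Proof. by rewrite [in LHS](consE u) dotv_cons. Qed.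

(** The shift splits into one of the tail, which is the induction hypothesis on sections over a
    fixed head, and one of the head on the line. *)
Lemma lebn_shiftv n (u : n.-tuple R) s (A : set (n.-tuple R)) : measurable A ->
  lebn ((fun x => shiftv x u s) @^-1` A) = lebn A.
Proof.
elim: n u A => [|n IH] u A mA.
  rewrite (_ : _ @^-1` _ = A)//; apply/seteqP.
  by split => x /=; rewrite (tuple0 (shiftv _ _ _)) (tuple0 x).
have [m mE] := @ex_lebn R n.
rewrite !lebnS -mE.
have mcA : measurable (@consp R n @^-1` A).
  by apply: measurable_preimage => //; exact: measurable_consp.
pose tr (p : TR * n.-tuple R) : TR * n.-tuple R := (p.1 + s * thead u, p.2).
have mtr : measurable_fun setT tr.
  by apply: measurable_fun_pair => //; exact: measurable_funD.
pose B := tr @^-1` (@consp R n @^-1` A).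
have mB : measurable B by exact: measurable_preimage.
have -> : ((mu \x m) (@consp R n @^-1` ((fun x => shiftv x u s) @^-1` A)) =
           (mu \x m) B)%E.
  apply: eq_product_xsection => a; rewrite mE.
  rewrite -(IH (tailt u) (xsection B a)); last exact: measurable_xsection.
  congr lebn; rewrite !xsectionE; apply/seteqP.
  by split => x; rewrite /B /tr /preimage/= shiftv_consp.
apply: eq_product_ysection => // y.
rewrite -[RHS](_ : (`|1|^-1%:E * mu (ysection (@consp R n @^-1` A) y))%E = _);
  last by rewrite normr1 invr1 mul1e.
rewrite -(@lebesgue_measure_affine R 1 (s * thead u)) ?oner_eq0//; last first.
  exact: measurable_ysection.
congr (mu _); rewrite !ysectionE; apply/seteqP.
by split => x; rewrite /B /tr /preimage/= mul1r.
Qed.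

(* Coordinates [(<x,u>, y)] on R^n, with [y] indexing the lines parallel to [u],
   in which [lebn] becomes a product measure. *)
Record line_coordinates n (u : n.-tuple R) d (Z : measurableType d)
    (nu : {sigma_finite_measure set Z -> \bar R}) := LineCoordinates {
  to_line : n.-tuple R -> TR * Z;
  of_line : TR * Z -> n.-tuple R;
  measurable_to_line : measurable_fun setT to_line;
  measurable_of_line : measurable_fun setT of_line;
  to_lineK : cancel to_line of_line;
  of_lineK : cancel of_line to_line;
  to_line1 : forall x, (to_line x).1 = dotv x u;
  to_line_shiftv : forall x s,
    to_line (shiftv x u s) = ((to_line x).1 + s, (to_line x).2);
  lebn_to_line : forall A, measurable A -> lebn (to_line @^-1` A) = (mu \x nu)%E A }.

Definition has_line_coordinates n (u : n.-tuple R) :=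
  exists d (Z : measurableType d) (nu : {sigma_finite_measure set Z -> \bar R}),
    inhabited (line_coordinates u nu).

(** The line through [x] parallel to [u] is indexed by its intersection with the hyperplane of first
    coordinate zero. The factor [|a|] in [nu] is the Jacobian. *)
Lemma line_coordinates_shear n (u : n.+1.-tuple R) : dotv u u = 1 ->
  thead u != 0 -> has_line_coordinates u.
Proof.
move=> uu u0; have [m mE] := @ex_lebn R n.
set a := thead u in u0 *; set v := tailt u.
have avv : a * a + dotv v v = 1.
  by rewrite -uu -dotv_cons; congr dotv; rewrite -[in RHS](unconspK u).
have a0 : 0 < `|a| by rewrite normr_gt0.
have [nu nuE] := ex_sigma_finite_scale m a0.
pose Psi (x : n.+1.-tuple R) : TR * n.-tuple R :=
  (dotv x u, shiftv (tailt x) v (- (thead x / a))).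
(* How far to go along [u] from [(0, y)] to the point whose product with [u] is the prescribed
   one. *)
pose tau (p : TR * n.-tuple R) : TR := p.1 - dotv p.2 v.
pose Phi (p : TR * n.-tuple R) : n.+1.-tuple R :=
  consp (tau p * a, shiftv p.2 v (tau p)).
have mtau : measurable_fun setT tau.
  apply: measurable_funB => //.
  apply: (@measurableT_comp _ _ _ _ _ _ (fun x : n.-tuple R => dotv x v)) => //.
  exact: measurable_dotv.
have mPsi : measurable_fun setT Psi.
  apply: measurable_fun_pair; first exact: measurable_dotv.
  apply: measurable_shiftv; first exact: measurable_behead.
  apply: measurable_funN; apply: measurable_funM => //.
  exact: measurable_tnth.
have mPhi : measurable_fun setT Phi.
  apply: (@measurableT_comp _ _ _ _ _ _ (@consp R n)); first exact: measurable_consp.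
  apply: measurable_fun_pair; first exact: measurable_funM.
  exact: measurable_shiftv.
have Psi_consp b x : Psi (consp (b, x)) =
    (b * a + dotv x v, shiftv x v (- (b / a))).
  by rewrite /Psi tailt_consp thead_consp dotv_consp.
have PsiK : cancel Psi Phi.
  move=> x; rewrite -[in RHS](unconspK x) (consE x) Psi_consp /Phi.
  set b := thead x; set y := tailt x.
  have -> : tau (b * a + dotv y v, shiftv y v (- (b / a))) = b / a.
    rewrite /tau/= dotv_shiftv.
    have -> : dotv v v = 1 - a * a by rewrite -avv; ring.
    by field.
  by rewrite shiftvD addNr shiftv0 divfK// /unconsp thead_consp tailt_consp.
have PhiK : cancel Phi Psi.
  move=> [s y]; rewrite /Phi Psi_consp/= dotv_shiftv shiftvD mulfK// subrr shiftv0.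
  congr pair; rewrite /tau/=.
  have -> : dotv v v = 1 - a * a by rewrite -avv; ring.
  by ring.
exists _, (n.-tuple R), nu; split.
refine (LineCoordinates (to_line := Psi) mPsi mPhi PsiK PhiK _ _ _) => //.
  move=> x s; rewrite /Psi dotv_shiftv uu mulr1; congr pair => /=.
  rewrite {1 2}(consE x) shiftv_consp thead_consp tailt_consp.
  by rewrite -/a -/v shiftvD; congr shiftv; field.
move=> A mA.
(* For a fixed head [b], [Psi] is this map after the translation of the tail by [-(b / a) v], which
   preserves measure. What remains, for a fixed tail, is affine of slope [a^-1]. *)
pose shear (p : TR * n.-tuple R) : TR * n.-tuple R :=
  (a^-1 * p.1 + dotv p.2 v, p.2).
have mshear : measurable_fun setT shear.
  apply: measurable_fun_pair => //; apply: measurable_funD.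
    by apply: measurable_funM.
  apply: (@measurableT_comp _ _ _ _ _ _ (fun x : n.-tuple R => dotv x v)) => //.
  exact: measurable_dotv.
pose B := shear @^-1` A.
have mB : measurable B by exact: measurable_preimage.
have -> : lebn (Psi @^-1` A) = (mu \x m)%E B.
  rewrite lebnS -mE; apply: eq_product_xsection => b; rewrite mE.
  rewrite -(@lebn_shiftv _ v (- (b / a)) (xsection B b)); last first.
    exact: measurable_xsection.
  congr lebn; rewrite !xsectionE; apply/seteqP.
  have key x : Psi (consp (b, x)) = shear (b, shiftv x v (- (b / a))).
    rewrite Psi_consp /shear/= dotv_shiftv; congr pair.
    have -> : dotv v v = 1 - a * a by rewrite -avv; ring.
    by field.
  by split => x; rewrite /B /preimage/= key.
rewrite !product_measure_ysection//.
have mg : measurable_fun setT (fun y => mu (ysection A y)).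
  exact: (measurable_fun_ysection (@lebesgue_measure R)).
rewrite [RHS](eq_measure_integral (mscale (NngNum (ltW a0)) m)); last first.
  by move=> C mC _; exact: nuE.
rewrite ge0_integral_mscale//= -ge0_integralZl//.
apply: eq_integral => y _.
have -> : ysection B y = (fun x : R => a^-1 * x + dotv y v) @^-1` ysection A y.
  by rewrite !ysectionE; apply/seteqP; split.
rewrite lebesgue_measure_affine ?invr_eq0//; last exact: measurable_ysection.
by rewrite normfV invrK.
Qed.

(** A first coordinate orthogonal to [u] becomes part of the index of the line; Tonelli exchanges it
    with the coordinate along the line. *)
Lemma line_coordinates_cons n (u : n.+1.-tuple R) : thead u = 0 ->
  has_line_coordinates (tailt u) -> has_line_coordinates u.
Proof.
move=> u0 [d [Z [nu [[P Q mP mQ PK QK P1 Pshift PE]]]]].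
have [nu' nu'E] := ex_sigma_finite_product (@lebesgue_measure R) nu.
have [m mE] := @ex_lebn R n.
pose Psi (x : n.+1.-tuple R) : TR * (TR * Z) :=
  ((P (tailt x)).1, (thead x, (P (tailt x)).2)).
pose Phi (p : TR * (TR * Z)) : n.+1.-tuple R := consp (p.2.1, Q (p.1, p.2.2)).
have mPt : measurable_fun setT (fun x : n.+1.-tuple R => P (tailt x)).
  by apply: measurableT_comp => //; exact: measurable_behead.
have mPsi : measurable_fun setT Psi.
  apply: measurable_fun_pair; first exact: measurableT_comp.
  apply: measurable_fun_pair; first exact: measurable_tnth.
  exact: measurableT_comp.
have mPhi : measurable_fun setT Phi.
  apply: (@measurableT_comp _ _ _ _ _ _ (@consp R n)); first exact: measurable_consp.
  apply: measurable_fun_pair; first exact: measurableT_comp.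
  apply: measurableT_comp => //; apply: measurable_fun_pair => //.
  exact: measurableT_comp.
have Psi_consp b x : Psi (consp (b, x)) = ((P x).1, (b, (P x).2)).
  by rewrite /Psi thead_consp tailt_consp.
exists _, (TR * Z)%type, nu'; split.
refine (LineCoordinates (to_line := Psi) (of_line := Phi) mPsi mPhi _ _ _ _ _).
- move=> x; rewrite /Phi/= -surjective_pairing PK; exact: unconspK.
- by move=> [s [a z]]; rewrite /Phi Psi_consp/= QK.
- by move=> x; rewrite [in RHS](consE x) dotv_consp u0 mulr0 add0r /Psi/= P1.
- move=> x s; rewrite [in LHS](consE x) shiftv_consp Psi_consp Pshift u0 mulr0.
  by rewrite addr0.
move=> A mA.
pose h (p : TR * TR) : \bar R := nu [set z | A (p.2, (p.1, z))].
pose C : set ((TR * TR) * Z) := (fun q => (q.1.2, (q.1.1, q.2))) @^-1` A.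
have mC : measurable C.
  apply: measurable_preimage => //; apply: measurable_fun_pair.
    exact: measurableT_comp.
  apply: measurable_fun_pair => //; exact: measurableT_comp.
have mh : measurable_fun setT h.
  have -> : h = nu \o xsection C by apply/funext => p; rewrite /h/= xsectionE.
  exact: measurable_fun_xsection.
transitivity (\int[mu]_a \int[mu]_s h (a, s))%E.
  rewrite lebnS -mE; apply: eq_integral => a _ /=.
  pose D : set (TR * Z) := (fun q => (q.1, (a, q.2))) @^-1` A.
  have mD : measurable D.
    apply: measurable_preimage => //; apply: measurable_fun_pair => //.
    exact: measurable_fun_pair.
  have -> : m (xsection (@consp R n @^-1` (Psi @^-1` A)) a) = lebn (P @^-1` D).
    rewrite mE; congr lebn; rewrite xsectionE; apply/seteqP.
    by split => x; rewrite /D /preimage/= Psi_consp.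
  rewrite PE//; apply: eq_integral => s _ /=.
  by congr (nu _); rewrite xsectionE.
rewrite (fubini_tonelli h)//; apply: eq_integral => s _ /=.
rewrite nu'E; apply: eq_integral => a _ /=.
by congr (nu _); rewrite !xsectionE.
Qed.

Lemma ex_line_coordinates n (u : n.-tuple R) : dotv u u = 1 ->
  has_line_coordinates u.
Proof.
elim: n u => [|n IH] u uu.
  by move: uu; rewrite /dotv big_ord0 => /eqP; rewrite eq_sym oner_eq0.
have [u0|u0] := eqVneq (thead u) 0; last exact: line_coordinates_shear.
apply: line_coordinates_cons => //; apply: IH.
by rewrite -uu [in RHS](consE u) -[LHS]add0r -[0](mulr0 0) -{1 2}u0 -dotv_cons.
Qed.

End fibration.

(** * Upper integrals and null sets *)

Section upper_integral.
Local Open Scope ereal_scope.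
Context d (T : measurableType d) (R : realType).
Variable m : {measure set T -> \bar R}.
Implicit Types g h : T -> \bar R.

(** Raising the majorant to [+oo] on [M] leaves its integral unchanged and makes it a majorant
    everywhere. *)
Lemma upint_le g h (M : set T) : measurable M -> m M = 0 ->
  measurable_fun setT h -> (forall x, 0 <= h x) ->
  (forall x, ~ M x -> g x <= h x) -> upint m g <= \int[m]_x h x.
Proof.
move=> mM M0 mh h0 gh.
pose h' x := if x \in M then +oo else h x.
have mh' : measurable_fun setT h'.
  apply: measurable_fun_ifT => //.
  apply: (measurable_fun_bool true); rewrite setTI.
  by rewrite (_ : _ @^-1` _ = M)//; apply/seteqP; split => x /= => [/set_mem|/mem_set].
have -> : \int[m]_x h x = \int[m]_x h' x.
  apply: ge0_ae_eq_integral => //.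
    by move=> x _; rewrite /h'; case: ifP.
  exists M; split => // x /= hx; apply: contrapT => Mx; apply: hx => _.
  by rewrite /h' memNset.
apply: ge_ereal_inf; exists (\int[m]_x h' x) => //.
exists h' => //; split => // x; rewrite /h'; case: ifPn => [_|].
  by rewrite leey.
by rewrite notin_setE => /gh.
Qed.

Lemma upint_ge0 g : (forall x, 0 <= g x) -> 0 <= upint m g.
Proof.
move=> g0; apply: le_ereal_inf_tmp => _ [h [_ gh] <-].
by apply: integral_ge0 => x _; exact: le_trans (gh x).
Qed.

Lemma upint_ae_le g1 g2 (M : set T) : measurable M -> m M = 0 ->
  (forall x, 0 <= g1 x) -> (forall x, ~ M x -> g2 x <= g1 x) ->
  upint m g2 <= upint m g1.
Proof.
move=> mM M0 g10 g21; apply: le_ereal_inf_tmp => _ [h [mh gh] <-].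
apply: (upint_le mM M0 mh); first by move=> x; exact: le_trans (gh x).
by move=> x /g21 /le_trans; exact.
Qed.

End upper_integral.

(** * An inequality between powers *)

Section pointwise.
Context {R : realType}.
Implicit Types (a b p : R).

(* From [x `^ p <= x] on [0, 1], applied to [(a - b) / a] and [b / a]. *)
Lemma powR_dist_le a b p : 0 <= a -> 0 <= b -> 1 <= p ->
  `|a - b| `^ p <= `|a `^ p - b `^ p|.
Proof.
move=> a0 b0 p1.
wlog ba : a b a0 b0 / b <= a.
  move=> H; have [|/ltW] := leP b a; first exact: H.
  by rewrite distrC (distrC (a `^ p)); exact: H.
have p0 : p != 0 by lra.
have pap x : 0 <= x <= 1 -> x `^ p <= x.
  move=> /andP[x0 x1]; have [->|xn0] := eqVneq x 0; first by rewrite powR0.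
  by apply: ge1r_powR => //; rewrite lt_neqAle eq_sym xn0 x0.
have [a00|an0] := eqVneq a 0.
  have -> : b = 0 by lra.
  by rewrite a00 subrr normr0 powR0.
have agt0 : 0 < a by rewrite lt_neqAle eq_sym an0.
have apb : b `^ p <= a `^ p by apply: ge0_ler_powR; rewrite ?nnegrE//; lra.
rewrite !ger0_norm ?subr_ge0//.
have -> : a - b = a * ((a - b) / a) by field.
have {2}-> : b = a * (b / a) by field.
have x01 : 0 <= (a - b) / a <= 1.
  by rewrite divr_ge0 ?subr_ge0//= ler_pdivrMr// mul1r; lra.
have y01 : 0 <= b / a <= 1 by rewrite divr_ge0//= ler_pdivrMr// mul1r.
have /andP[x0 _] := x01; have /andP[y0 _] := y01.
rewrite (powRM p a0 x0) (powRM p a0 y0).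
have := pap _ x01; have := pap _ y01.
have ap0 : 0 <= a `^ p by exact: powR_ge0.
move=> yp xp.
have H : (a - b) / a = 1 - b / a by field.
have HX : a `^ p * ((a - b) / a) = a `^ p - a `^ p * (b / a).
  by rewrite H mulrBr mulr1.
apply: (le_trans (ler_wpM2l ap0 xp)); rewrite HX lerD2l lerN2.
exact: ler_wpM2l.
Qed.

End pointwise.

(** * Indicators: from functions to sets *)

Section indicators.
Context {R : realType} (n : nat).
Implicit Types (H : ohyp R n) (A : set (n.-tuple R)).

Lemma polar_indic H A : polar H (\1_A : _ -> R) = \1_(polar_set H A).
Proof.
apply/funext => x; rewrite /polar !indicE.
have maxE (b1 b2 : bool) : Num.max b1%:R b2%:R = (b1 || b2)%:R :> R.
  by case: b1 b2 => -[] /=; rewrite ?maxxx ?(max_l ler01) ?(max_r ler01)//.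
have minE (b1 b2 : bool) : Num.min b1%:R b2%:R = (b1 && b2)%:R :> R.
  by case: b1 b2 => -[] /=; rewrite ?minxx ?(min_l ler01) ?(min_r ler01)//.
case: leP => xH.
  rewrite maxE; congr (nat_of_bool _)%:R; apply/idP/idP.
    by move=> /orP[|] /set_mem Ax; apply/mem_set; left; split => //; [left|right].
  move=> /set_mem[[_ []]|[xm [Ax _]]]; [|move=> /mem_set -> //|].
    by move=> /mem_set ->.
    by rewrite orbT.
  by rewrite (mem_set Ax).
rewrite minE; congr (nat_of_bool _)%:R; apply/idP/idP.
  move=> /andP[/set_mem Ax /set_mem Ax']; apply/mem_set; right.
  by split => //; exact: ltW.
move=> /set_mem[[xp _]|[_ [/mem_set -> /mem_set ->//]]].
by move: xp; rewrite /hplus leNgt xH.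
Qed.

Lemma polar_comp_indic s A :
  polar_comp s (\1_A : _ -> R) = \1_(polar_set_comp s A).
Proof. by elim: s => //= H s IH; rewrite /= -polar_indic -IH. Qed.

Lemma solynin_set10 t (x : R) : x != t -> ~ solynin_set1 t set0 x.
Proof.
move=> xt [[]//|]; rewrite measure0 leNgt => /negP; apply.
have xt0 : 0 < `|x - t| by rewrite normr_gt0 subr_eq0.
have := @mu_sol_image1_grow R t 0 `|x - t| set0 measurable0.
rewrite lexx ltW// => /(_ isT) H; apply: lt_le_trans H.
rewrite subr0; apply: (@lt_le_trans _ _ (`|x - t|%:E)); first by rewrite lte_fin.
by rewrite -[leLHS]add0e leeD2r.
Qed.

Lemma solynin_indic H A x : dotv x (hnormal H) != hoffset H ->
  solynin H (\1_A : _ -> R) x = \1_(sol_set H A) x.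
Proof.
move=> xt; rewrite /solynin.
have lev (s : R) : 0 < s -> [set y | s < \1_A y] = if s < 1 then A else set0.
  move=> s0; apply/seteqP; case: ifPn => [s1|]; last rewrite -leNgt => s1.
    split=> y /=; rewrite indicE; last by move/mem_set => ->.
    by case: (boolP (y \in A)) => [/set_mem//|_] /=; rewrite ltNge ltW.
  by split=> y //=; rewrite indicE; case: (y \in A); rewrite ?ltNge ?s1// ltW.
have n0 : ~ sol_set H set0 x.
  rewrite /sol_set/=.
  move=> /(@sol_set1_ae R _ set0 _ set0 measurable0); rewrite measure0.
  move=> /(_ (ltry _) measurable0 erefl) H'.
  by apply: (solynin_set10 xt); apply: H'.
have [Ax|Ax] := pselect (sol_set H A x).
  rewrite indicE mem_set//.
  rewrite (_ : [set _ | _] = `]0, 1[%classic) ?sup_itv// ?bnd_simp//.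
  apply/seteqP; split=> s /=; rewrite in_itv/=.
    by move=> [s0]; rewrite lev// s0; case: ifP.
  by move=> /andP[s0 s1]; split => //; rewrite lev// s1.
rewrite indicE memNset//.
rewrite (_ : [set _ | _] = set0) ?sup0//.
by apply/seteqP; split=> s //= [s0]; rewrite lev//; case: ifP.
Qed.

End indicators.

Section powers.
Context {R : realType}.
Implicit Types (x y p : R).

Lemma ltr_powR2 p x y : 0 < p -> 0 <= x -> 0 <= y -> (x `^ p < y `^ p) = (x < y).
Proof.
move=> p0 x0 y0; apply/idP/idP => xy; last exact: gt0_ltr_powR.
rewrite ltNge; apply/negP => yx; move: xy; rewrite ltNge => /negP; apply.
by apply: ge0_ler_powR; rewrite ?nnegrE//; exact: ltW.
Qed.

Lemma powR_root p x : 0 < p -> 0 <= x -> (x `^ p^-1) `^ p = x.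
Proof. by move=> p0 x0; rewrite -powRrM mulVf ?gt_eqF// powRr1. Qed.

End powers.

(** * The rearrangement of a function along one line *)

Section solynin_of_functions_on_the_line.
Context {R : realType}.
Notation mu := (@lebesgue_measure R).
Variables (t p : R) (phi F : R -> R) (M : set R) (x : R).
Hypotheses (p0 : 0 < p) (mF : measurable_fun setT F).
Hypotheses (F0 : forall y, 0 <= F y) (phi0 : forall y, 0 <= phi y).
Hypotheses (Foo : (\int[mu]_y (F y)%:E < +oo)%E).
Hypotheses (mM : measurable M) (M0 : mu M = 0%E).
Hypotheses (phiF : forall y, ~ M y -> phi y `^ p = F y).
Hypotheses (Mx : ~ M x) (xt : x != t).

Let lev (v : R) : set R := [set y | v < F y].

Lemma measurable_superlevel v : measurable (lev v).
Proof.
rewrite (_ : lev v = F @^-1` `]v, +oo[%classic); last first.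
  by apply/seteqP; split => y; rewrite /lev/= in_itv/= andbT.
by apply: measurable_preimage => //; exact: measurable_itv.
Qed.

Lemma superlevel_markov v : 0 < v -> (v%:E * mu (lev v) <= \int[mu]_y (F y)%:E)%E.
Proof.
move=> v0; have mL := measurable_superlevel v.
have -> : (v%:E * mu (lev v))%E = (\int[mu]_y (v * \1_(lev v) y)%:E)%E.
  under eq_integral do rewrite EFinM.
  rewrite ge0_integralZl//; last first.
  - by rewrite lee_fin ltW.
  - by apply/measurable_EFinP; exact: measurable_indic.
  by rewrite integral_indic// setIT.
apply: ge0_le_integral => //.
- by move=> y _; rewrite lee_fin mulr_ge0// ltW.
- by apply/measurable_EFinP; apply: measurable_funM => //; exact: measurable_indic.
- exact/measurable_EFinP.
- move=> y _; rewrite lee_fin indicE.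
  case: (boolP (y \in lev v)) => [/set_mem/ltW|_]; rewrite ?mulr1 ?mulr0//.
Qed.

Lemma superlevel_ltoo v : 0 < v -> (mu (lev v) < +oo)%E.
Proof.
move=> v0; rewrite ltey; apply/eqP => Loo.
have := superlevel_markov v0; rewrite Loo gt0_muley ?lte_fin//.
by rewrite leye_eq => /eqP H; move: Foo; rewrite H.
Qed.

Lemma sol_set1_superlevel s : 0 < s ->
  (sol_set1 t [set y | s < phi y] x <-> solynin_set1 t (lev (s `^ p)) x).
Proof.
move=> s0; have sp0 : 0 < s `^ p by exact: powR_gt0.
apply: (sol_set1_ae t (measurable_superlevel _) (superlevel_ltoo sp0) mM M0) => //.
by move=> y My; rewrite /lev/= -phiF// ltr_powR2// ltW.
Qed.

Lemma solynin_set1_superlevel_mono s s' : 0 < s -> s <= s' ->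
  solynin_set1 t (lev (s' `^ p)) x -> solynin_set1 t (lev (s `^ p)) x.
Proof.
move=> s0 ss'; apply: solynin_set1_mono; try exact: measurable_superlevel.
  by apply: superlevel_ltoo; exact: powR_gt0.
move=> y; rewrite /lev/=; apply: le_lt_trans.
apply: ge0_ler_powR; rewrite ?nnegrE//; first exact: ltW.
  exact: ltW.
exact: le_trans (ltW s0) ss'.
Qed.

Definition solynin1 := sup [set s | 0 < s /\ sol_set1 t [set y | s < phi y] x].

Let S := [set s | 0 < s /\ sol_set1 t [set y | s < phi y] x].

(** Needed for the supremum to be meaningful. Off H, a point belongs to the image of a level set
    either through the set itself or because that level set has measure at least [|x - t|], which
    Markov's inequality excludes at high levels. *)
Lemma has_ubound_levels : has_ubound S.
Proof.
set I := fine (\int[mu]_y (F y)%:E).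
have IE : (\int[mu]_y (F y)%:E)%E = I%:E.
  rewrite fineK// ge0_fin_numE//; apply: integral_ge0 => y _.
  by rewrite lee_fin.
have I0 : 0 <= I by rewrite -lee_fin -IE; apply: integral_ge0 => y _; rewrite lee_fin.
have e0 : 0 < `|x - t| by rewrite normr_gt0 subr_eq0.
set e := `|x - t| in e0.
(* [F x] rules out the first clause, [I / e] the second by Markov, and [1] makes both strict. *)
pose V := F x + I / e + 1.
have V0 : 0 < V by rewrite /V ltr_wpDl// addr_ge0// divr_ge0// ltW.
exists (V `^ p^-1) => s [s0].
rewrite sol_set1_superlevel// => H.
rewrite leNgt; apply/negP => Vs.
have VS : solynin_set1 t (lev V) x.
  rewrite -[V](powR_root p0 (ltW V0)); apply: solynin_set1_superlevel_mono H.
    exact: powR_gt0.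
  exact: ltW.
case: VS => [[_]|]; first by rewrite /lev/= /V; have := divr_ge0 I0 (ltW e0); lra.
rewrite -/e => He.
have H1 := @mu_sol_image1_grow R t 0 e (lev V) (measurable_superlevel V).
have {}H1 : (e%:E <= mu (lev V))%E.
  apply: le_trans He; apply: le_trans (H1 _); last by rewrite lexx ltW.
  by rewrite subr0 -[leLHS]add0e leeD2r.
have H2 := superlevel_markov V0.
have H3 : ((V * e)%:E <= I%:E)%E.
  rewrite -IE; apply: le_trans H2; rewrite EFinM.
  by apply: lee_pmul => //; rewrite lee_fin ltW.
rewrite lee_fin in H3.
have : (V - F x - 1) * e = I by rewrite /V; field; rewrite gt_eqF.
have := mulr_ge0 (F0 x) (ltW e0); nra.
Qed.

Lemma solynin1_ge0 : 0 <= solynin1.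
Proof.
rewrite /solynin1 -/S; have [->|/set0P[s Ss]] := eqVneq S set0; first by rewrite sup0.
apply: le_trans (_ : s <= _); first by case: Ss => /ltW.
by apply: ub_le_sup => //; exact: has_ubound_levels.
Qed.

(** With [gt_solynin1] this decides membership at every positive level except the value itself, a
    single level. *)
Lemma lt_solynin1 s : 0 < s -> s < solynin1 -> solynin_set1 t (lev (s `^ p)) x.
Proof.
move=> s0 sb.
have S0 : S !=set0.
  apply/set0P/eqP => SE; move: sb; rewrite /solynin1 -/S SE sup0; lra.
have [s' [s'0 s'S] ss'] := sup_gt S0 sb.
by apply: (solynin_set1_superlevel_mono s0 (ltW ss')); apply/sol_set1_superlevel.
Qed.

Lemma gt_solynin1 s : 0 < s -> solynin1 < s -> ~ solynin_set1 t (lev (s `^ p)) x.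
Proof.
move=> s0 bs /(sol_set1_superlevel s0) H.
have : s <= solynin1 by apply: ub_le_sup => //; exact: has_ubound_levels.
by lra.
Qed.

End solynin_of_functions_on_the_line.

(** Regrouping with the last factor integrated first. With levels as that factor, it turns the
    measure of a set over lines and levels into an integral of lengths of slices. *)
Lemma product_measure_assoc (R : realType) d1 d2 d3 (T1 : measurableType d1)
    (T2 : measurableType d2) (T3 : measurableType d3)
    (m1 : {sigma_finite_measure set T1 -> \bar R})
    (m2 : {sigma_finite_measure set T2 -> \bar R})
    (m3 : {sigma_finite_measure set T3 -> \bar R})
    (m23 : {sigma_finite_measure set (T2 * T3)%type -> \bar R}) :
  (m23 : set (T2 * T3) -> \bar R) = (m2 \x m3)%E ->
  forall C : set (T1 * (T2 * T3)), measurable C ->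
  let h p := m3 [set z | C (p.1, (p.2, z))] in
  measurable_fun setT h /\ ((m1 \x m23) C = \int[m1 \x m2]_p h p)%E.
Proof.
move=> m23E C mC h.
pose D : set ((T1 * T2) * T3) := (fun q => (q.1.1, (q.1.2, q.2))) @^-1` C.
have mD : measurable D.
  apply: measurable_preimage => //; apply: measurable_fun_pair.
    exact: measurableT_comp.
  apply: measurable_fun_pair => //; exact: measurableT_comp.
have mh : measurable_fun setT h.
  have -> : h = m3 \o xsection D by apply/funext => p; rewrite /h/= xsectionE.
  exact: measurable_fun_xsection.
split => //; rewrite fubini_tonelli1//; apply: eq_integral => x _ /=.
rewrite m23E; apply: eq_integral => y _ /=.
by congr (m3 _); rewrite !xsectionE.
Qed.

(** * Convergence for functions *)

Section parallel_hyperplanes.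
Context {R : realType} (n : nat) (H : ohyp R n).
Notation mu := (@lebesgue_measure R).
Notation TR := (measurableTypeR R).
Let u := hnormal H.
Let t := hoffset H.

Definition parallel (cs : seq R) : seq (ohyp R n) :=
  [seq OHyp c (hnormal_unit H) | c <- cs].

Context d (Z : measurableType d) (nu : {sigma_finite_measure set Z -> \bar R}).
Variable L : line_coordinates u nu.
Let P := to_line L.
Let Q := of_line L.
Implicit Types (f g : n.-tuple R -> R) (A X : set (n.-tuple R)) (c s : R)
  (cs : seq R) (x : n.-tuple R).

Lemma to_line_hreflect c x :
  P (hreflect (OHyp c (hnormal_unit H)) x) = (2 * c - (P x).1, (P x).2).
Proof.
rewrite /hreflect/= /P to_line_shiftv to_line1.
by congr pair; ring.
Qed.

(** A maximum exceeds [s] when one of the values does, a minimum when both do: polarization acts on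
    each strict superlevel set separately. *)
Lemma polar_comp_superlevel cs f s x : s < polar_comp (parallel cs) f x <->
  sweep1 cs [set y | s < f (Q (y, (P x).2))] (P x).1.
Proof.
elim: cs x => [|c cs IH] x /=.
  by rewrite -surjective_pairing /Q /P to_lineK.
have IH' := IH (hreflect (OHyp c (hnormal_unit H)) x).
rewrite to_line_hreflect/= in IH'.
have xE : dotv x (hnormal H) = (P x).1 by rewrite /P to_line1.
rewrite /polar/= xE.
case: (leP c (P x).1) => cx.
  rewrite lt_max; split.
    by move=> /orP[/IH ?|/IH' ?]; left; split => //; [left|right].
  by move=> [[_ [/IH ->//|/IH' ->]]|[_ [/IH -> _]]]; rewrite ?orbT.
rewrite lt_min; split.
  by move=> /andP[/IH ? /IH' ?]; right; split; [exact: ltW|].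
move=> [[cx' _]|[_ [/IH -> /IH' ->//]]].
by move: cx'; rewrite leNgt cx.
Qed.

Lemma sol_set_line A x :
  sol_set H A x = sol_set1 t [set y | A (Q (y, (P x).2))] (P x).1.
Proof.
rewrite /sol_set/= /P to_line1 -/u; congr (sol_set1 _ _ _).
apply/funext => y; rewrite /line_section/=; congr A.
apply: (can_inj (to_lineK L)); rewrite of_lineK to_line_shiftv to_line1.
by congr pair; ring.
Qed.

Lemma measurable_hreflect (K : ohyp R n) : measurable_fun setT (hreflect K).
Proof.
apply: measurable_shiftv => //; apply: measurable_funN.
apply: measurable_funM => //; apply: measurable_funB => //.
exact: measurable_dotv.
Qed.

Lemma lebn_hreflect c X : measurable X ->
  lebn (hreflect (OHyp c (hnormal_unit H)) @^-1` X) = lebn X.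
Proof.
move=> mX.
have mQX : measurable (Q @^-1` X).
  by apply: measurable_preimage => //; exact: measurable_of_line.
pose rho (q : TR * Z) : TR * Z := (2 * c - q.1, q.2).
have mrho : measurable_fun setT rho.
  by apply: measurable_fun_pair => //; exact: measurable_funB.
have mrX : measurable (rho @^-1` (Q @^-1` X)) by exact: measurable_preimage.
have -> : X = P @^-1` (Q @^-1` X).
  by apply/seteqP; split => x; rewrite /preimage/= /P /Q to_lineK.
have -> : hreflect (OHyp c (hnormal_unit H)) @^-1` (P @^-1` (Q @^-1` X)) =
    P @^-1` (rho @^-1` (Q @^-1` X)).
  by apply/seteqP; split => x; rewrite /preimage/= to_line_hreflect.
rewrite /P !lebn_to_line//; apply: eq_product_ysection => // z.
have mS : measurable (ysection (Q @^-1` X) z) by exact: measurable_ysection.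
rewrite -[RHS](mu_reflect1 c mS); congr (mu _); rewrite !ysectionE.
apply/seteqP; split => y; rewrite /reflect1 /rho /preimage/=;
  by have -> : 2 * c - y = -1 * y + 2 * c by ring.
Qed.

(** Each polarization adds the mirror image of the exceptional set, again null. *)
Lemma polar_comp_ae cs f g M : measurable M -> lebn M = 0%E ->
  (forall x, ~ M x -> f x = g x) ->
  exists M', [/\ measurable M', lebn M' = 0%E &
    forall x, ~ M' x -> polar_comp (parallel cs) f x = polar_comp (parallel cs) g x].
Proof.
move=> mM M0 fg; have [m mE] := @ex_lebn R n.
elim: cs => [|c cs [M' [mM' M'0 IH]]]; first by exists M.
set K := OHyp c (hnormal_unit H).
have mr : measurable (hreflect K @^-1` M').
  by apply: measurable_preimage => //; exact: measurable_hreflect.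
exists (M' `|` hreflect K @^-1` M'); split; first exact: measurableU.
  have M'm : m M' = 0%E by rewrite mE.
  have rm : m (hreflect K @^-1` M') = 0%E by rewrite mE /K lebn_hreflect.
  by rewrite -mE; exact: null_set_setU.
move=> x /not_orP[nx nrx]; rewrite /= /polar -!/(polar_comp _ _).
by rewrite (IH _ nx) (IH _ nrx).
Qed.

Lemma polar_comp_ge0 cs f : (forall x, 0 <= f x) ->
  forall x, 0 <= polar_comp (parallel cs) f x.
Proof.
move=> f0; elim: cs => [//|c cs IH] x /=; rewrite /polar -!/(polar_comp _ _).
by case: ifP => _; rewrite ?le_max ?le_min !IH.
Qed.

Section convergence.
Variables (p : R) (f g : n.-tuple R -> R) (M : set (n.-tuple R)).
Hypotheses (p1 : 1 <= p) (f0 : forall x, 0 <= f x) (g0 : forall x, 0 <= g x).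
Hypotheses (mg : measurable_fun setT g).
Hypotheses (mM : measurable M) (M0 : lebn M = 0%E).
Hypotheses (fg : forall x, ~ M x -> f x = g x).
Hypotheses (gint : (\int[@lebn R n]_x (g x `^ p)%:E < +oo)%E).

Let F (q : TR * Z) : R := g (Q q) `^ p.

Let p0 : 0 < p. Proof. by apply: lt_le_trans p1. Qed.

Let mF : measurable_fun setT F.
Proof.
apply: (@measurableT_comp _ _ _ _ _ _ (@powR R ^~ p)) => //.
by apply: measurableT_comp => //; exact: measurable_of_line.
Qed.

Let F0 q : 0 <= F q. Proof. exact: powR_ge0. Qed.

Lemma integral_to_line (h : TR * Z -> \bar R) : measurable_fun setT h ->
  (forall q, 0 <= h q)%E ->
  (\int[@lebn R n]_x h (P x) = \int[mu \x nu]_q h q)%E.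
Proof.
move=> mh h0; have [m mE] := @ex_lebn R n; rewrite -mE.
have [m' m'E] := ex_pushforward m (measurable_to_line L).
rewrite [RHS](eq_measure_integral m'); last first.
  move=> A mA _; have H0 := lebn_to_line L mA; rewrite -mE in H0.
  exact: etrans (esym H0) (esym (m'E _)).
have -> : (\int[m']_q h q = \int[pushforward m P]_q h q)%E.
  by congr integral; apply/funext => A; rewrite m'E.
by rewrite ge0_integral_pushforward//; exact: measurable_to_line.
Qed.

Let Fint : (\int[mu \x nu]_q (F q)%:E < +oo)%E.
Proof.
have FE : measurable_fun setT (fun q => (F q)%:E) by exact/measurable_EFinP.
rewrite -(integral_to_line FE); last by move=> q; rewrite lee_fin.
have -> : (fun x => (F (P x))%:E) = (fun x => (g x `^ p)%:E).
  by apply/funext => x; rewrite /F /P /Q to_lineK.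
exact: gint.
Qed.

(** The subgraph of the [p]-th power, grouped as line times index, the index being a pair of line
    and level. Its measure is the integral of [F]. *)
Let A : set (TR * (Z * TR)) := [set q | 0 < q.2.2 /\ q.2.2 < F (q.1, q.2.1)].

Let mA : measurable A.
Proof.
pose k (q : TR * (Z * TR)) : R := F (q.1, q.2.1) - q.2.2.
have m22 : measurable_fun setT (fun q : TR * (Z * TR) => q.2.2).
  exact: (@measurableT_comp _ _ _ _ _ _ (snd : Z * TR -> TR)).
have mk : measurable_fun setT k.
  apply: measurable_funB => //.
  apply: (@measurableT_comp _ _ _ _ _ _ F) => //; apply: measurable_fun_pair => //.
  exact: (@measurableT_comp _ _ _ _ _ _ (fst : Z * TR -> Z)).
have -> : A = ((fun q : TR * (Z * TR) => q.2.2) @^-1` `]0, +oo[%classic) `&`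
    (k @^-1` `]0, +oo[%classic).
  by apply/seteqP; split => q; rewrite /A /k/= !in_itv/= !andbT subr_gt0.
by apply: measurableI; apply: measurable_preimage => //; exact: measurable_itv.
Qed.

Let ysectionA z v : 0 < v -> ysection A (z, v) = [set y | v < F (y, z)].
Proof.
by move=> v0; rewrite ysectionE; apply/seteqP; split => y;
  rewrite /A/preimage/= v0 => // -[].
Qed.

Let Mline z : set R := [set y | M (Q (y, z))].

(** Lines on which the results for a single line do not apply: the trace of [M] is not null or [F]
    is not integrable. *)
Let bad : set Z := [set z | mu (Mline z) != 0%E] `|`
  [set z | \int[mu]_y (F (y, z))%:E = +oo]%E.

Let mMQ : measurable (Q @^-1` M).
Proof. by apply: measurable_preimage => //; exact: measurable_of_line. Qed.

Let MlineE z : Mline z = ysection (Q @^-1` M) z.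
Proof. by rewrite ysectionE. Qed.

Let mMline : measurable_fun setT (fun z => mu (Mline z)).
Proof.
under eq_fun do rewrite MlineE.
exact: (measurable_fun_ysection (@lebesgue_measure R)).
Qed.

Let mFline : measurable_fun setT (fun z => \int[mu]_y (F (y, z))%:E)%E.
Proof.
apply: (measurable_fun_fubini_tonelli_G (m1 := @lebesgue_measure R)
  (fun q => (F q)%:E)); first exact/measurable_EFinP.
by move=> q; rewrite lee_fin.
Qed.

Let measurable_bad : measurable bad.
Proof.
apply: measurableU.
  rewrite (_ : [set z | _] = (fun z => mu (Mline z)) @^-1` (~` [set 0%E])).
    by apply: measurable_preimage => //; exact/measurableC/emeasurable_set1.
  by apply/seteqP; split => z /= /eqP.
rewrite (_ : [set z | _] = (fun z => \int[mu]_y (F (y, z))%:E)%E @^-1` [set +oo%E])//.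
by apply: measurable_preimage => //; exact/emeasurable_set1.
Qed.

Let nu_bad : nu bad = 0%E.
Proof.
have FE : measurable_fun setT (fun q => (F q)%:E) by exact/measurable_EFinP.
apply: measure_negligible => //; apply: negligibleU.
  have : ae_eq nu setT (fun z => mu (Mline z)) (cst 0%E).
    apply/ae_eq_integral_abs => //.
    under eq_integral do rewrite gee0_abs// MlineE.
    rewrite -product_measure_ysection// -(lebn_to_line L mMQ) -[RHS]M0.
    by congr lebn; apply/seteqP; split => x; rewrite /preimage/= /Q to_lineK.
  apply: negligibleS => z /= /eqP zM; apply/not_implyP; split => //.
have : nu.-integrable setT (fun z => \int[mu]_y (F (y, z))%:E)%E.
  apply/integrableP; split => //.
  have F0e q : (0 <= (F q)%:E)%E by rewrite lee_fin.
  under eq_integral do rewrite gee0_abs ?integral_ge0//.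
  by have := Fint; rewrite (fubini_tonelli2 _ FE F0e).
move=> /(integrable_ae measurableT).
by apply: negligibleS => z /= zF; apply/not_implyP; split => //; rewrite zF.
Qed.

Let solynin_line x : solynin H f x =
  solynin1 t (fun y => f (Q (y, (P x).2))) (P x).1.
Proof.
rewrite /solynin /solynin1; congr sup.
by apply/funext => s; rewrite /mkset sol_set_line.
Qed.

Let measurable_slice k q : measurable [set v | gap t A k (q.1, (q.2, v))].
Proof.
rewrite (_ : [set v | _] = (fun v : TR => (q.1, (q.2, v))) @^-1` gap t A k)//.
apply: measurable_preimage; last exact: measurable_gap.
by do 2 apply: measurable_fun_pair => //.
Qed.

(* The slice of the gap set above a point of a good line has at least the length
   of the interval between the [p]-th powers of the two values. *)
Let gap_slice k x : ~ M x -> ~ bad (P x).2 -> (P x).1 != t ->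
  ((`|polar_comp (parallel (centers t k)) g x - solynin H f x| `^ p)%:E <=
   mu [set v | gap t A k ((P x).1, ((P x).2, v))])%E.
Proof.
move=> Mx; set s0 := (P x).1; set z := (P x).2 => nbad s0t.
have xE : Q (s0, z) = x by rewrite -surjective_pairing /Q /P to_lineK.
have mFz : measurable_fun setT (fun y => F (y, z)).
  exact: (measurable_fun_pair1 z mF).
have Fzoo : (\int[mu]_y (F (y, z))%:E < +oo)%E.
  by rewrite ltey; apply/eqP => Foo; apply: nbad; right.
have Mz0 : mu (Mline z) = 0%E.
  by apply/eqP; apply: contrapT => /negP Mz; apply: nbad; left.
have mMz : measurable (Mline z) by rewrite MlineE; exact: measurable_ysection.
have phiF y : ~ Mline z y -> f (Q (y, z)) `^ p = F (y, z).
  by move=> My; rewrite /F fg.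
have Msx : ~ Mline z s0 by rewrite /Mline/= xE.
have F0z y : 0 <= F (y, z) by [].
have phi0 y : 0 <= f (Q (y, z)) by [].
have b0 : 0 <= solynin H f x.
  rewrite solynin_line.
  exact: (solynin1_ge0 p0 mFz F0z phi0 Fzoo mMz Mz0 phiF Msx s0t).
set b := solynin H f x in b0 *.
set a := polar_comp _ g x.
have a0 : 0 <= a by exact: polar_comp_ge0.
have lowb s : 0 < s -> s < b -> fiber_solynin t A (s0, (z, s `^ p)).
  move=> s_gt0; rewrite /b solynin_line => sb.
  rewrite /fiber_solynin/= ysectionA ?powR_gt0//.
  exact: (lt_solynin1 p0 mFz F0z phi0 Fzoo mMz Mz0 phiF Msx s_gt0 sb).
have highb s : 0 < s -> b < s -> ~ fiber_solynin t A (s0, (z, s `^ p)).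
  move=> s_gt0; rewrite /b solynin_line => bs.
  rewrite /fiber_solynin/= ysectionA ?powR_gt0//.
  exact: (gt_solynin1 p0 mFz F0z phi0 Fzoo mMz Mz0 phiF Msx s0t s_gt0 bs).
have levela s : 0 < s -> (s < a <-> fiber_sweep (centers t k) A (s0, (z, s `^ p))).
  move=> s_gt0; rewrite /fiber_sweep/= ysectionA ?powR_gt0//.
  rewrite (_ : [set y | _] = [set y | s < g (Q (y, z))]).
    exact: polar_comp_superlevel.
  by apply/funext => y; rewrite /mkset /F ltr_powR2// ltW.
(* For [c] and [e] the smaller and the larger of [a] and [b]; levels of the function and of its
   power are related by [v = s ^ p]. *)
have slice_sub (c e : R) : 0 <= c -> c <= e ->
    (forall s, c < s -> s < e -> gap t A k (s0, (z, s `^ p))) ->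
    ((e `^ p - c `^ p)%:E <= mu [set v | gap t A k (s0, (z, v))])%E.
  move=> c0 ce Hs.
  have cep : c `^ p <= e `^ p.
    by apply: ge0_ler_powR; rewrite ?nnegrE//; [exact: ltW|exact: le_trans ce].
  have -> : (e `^ p - c `^ p)%:E = mu `]c `^ p, e `^ p[%classic.
    rewrite lebesgue_measure_itv/= lte_fin; case: ifPn => // H0.
    by congr EFin; move: H0; rewrite -leNgt; lra.
  apply: le_mu; [exact: measurable_itv|exact: (measurable_slice k (s0, z))|].
  move=> v /=; rewrite in_itv/= => /andP[cv ve].
  have v0 : 0 < v by apply: le_lt_trans cv; exact: powR_ge0.
  have vE := powR_root p0 (ltW v0).
  have r0 : 0 <= v `^ p^-1 by exact: powR_ge0.
  have e0 : 0 <= e by exact: le_trans ce.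
  rewrite -vE; apply: Hs.
    by rewrite -(ltr_powR2 p0)// vE.
  by rewrite -(ltr_powR2 p0)// vE.
apply: (@le_trans _ _ (`|a `^ p - b `^ p|%:E)).
  by rewrite lee_fin; exact: powR_dist_le.
have [ba|/ltW ab] := leP b a.
  rewrite ger0_norm; last first.
    by rewrite subr_ge0; apply: ge0_ler_powR; rewrite ?nnegrE// ltW.
  apply: slice_sub => // s bs sa.
  have s_gt0 : 0 < s by exact: le_lt_trans bs.
  by left; split; [exact/levela|exact: highb].
rewrite distrC ger0_norm; last first.
  by rewrite subr_ge0; apply: ge0_ler_powR; rewrite ?nnegrE// ltW.
apply: slice_sub => // s as_ sb.
have s_gt0 : 0 < s by exact: le_lt_trans as_.
by right; split; [exact: lowb|move/(levela _ s_gt0); lra].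
Qed.

Lemma cvg_Lp_dist_pow :
  (fun k => Lp_dist_pow p (polar_comp (parallel (centers t k)) f) (solynin H f))
    @ \oo --> 0%E.
Proof.
have [m mE] := @ex_lebn R n.
have [nu' nu'E] := ex_sigma_finite_product nu (@lebesgue_measure R).
have Aoo : ((mu \x nu') A < +oo)%E.
  have [_ ->] := product_measure_assoc (@lebesgue_measure R) nu'E mA.
  rewrite (eq_integral (fun q => (F q)%:E))// => -[y z] _ /=.
  rewrite (_ : [set v | _] = `]0, F (y, z)[%classic); last first.
    apply/seteqP; split => v; rewrite /A/= in_itv/=; first by move=> [-> ->].
    by move=> /andP[].
  rewrite lebesgue_measure_itv/= lte_fin oppr0 adde0; case: ifPn => //.
  rewrite -leNgt => Fle; congr EFin; apply/eqP.
  by rewrite eq_le Fle F0.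
have := cvg_gap t mA Aoo; apply: squeeze_cvge => //; last exact: cvg_cst.
apply: nearW => k; apply/andP; split.
  by rewrite /Lp_dist_pow -mE; apply: upint_ge0 => x; rewrite lee_fin powR_ge0.
have mgap := measurable_gap t k mA.
have [mh ->] := product_measure_assoc (@lebesgue_measure R) nu'E mgap.
set h := fun q => _ in mh *.
rewrite -(integral_to_line mh)// /Lp_dist_pow.
have [M' [mM' M'0 fgM']] := polar_comp_ae (centers t k) mM M0 fg.
(* [E1] is the union of the bad lines and [E2] is H. *)
pose E1 := P @^-1` (setT `*` bad); pose E2 := P @^-1` ([set t] `*` setT).
have mE1 : measurable E1.
  by apply: measurable_preimage; [exact: measurable_to_line|exact: measurableX].
have mE2 : measurable E2.
  by apply: measurable_preimage; [exact: measurable_to_line|exact: measurableX].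
have E10 : m E1 = 0%E.
  rewrite mE lebn_to_line; last exact: measurableX.
  by rewrite product_measure1E// nu_bad mule0.
have E20 : m E2 = 0%E.
  rewrite mE lebn_to_line; last exact: measurableX.
  have t0 : mu [set t] = 0%E by exact: lebesgue_measure_set1.
  rewrite product_measure1E//=.
  by apply: (etrans _ (mul0e (nu setT))); congr (_ * _)%E.
have mM0 : m M = 0%E by rewrite mE.
have mM'0 : m M' = 0%E by rewrite mE.
rewrite -mE; apply: (@upint_le _ _ _ m _ _ ((M `|` M') `|` (E1 `|` E2))).
- by apply: measurableU; exact: measurableU.
- by rewrite null_set_setU//; try exact: measurableU; exact: null_set_setU.
- by apply: measurableT_comp => //; exact: measurable_to_line.
- by [].
- move=> x /not_orP[/not_orP[nM nM'] /not_orP[n1 n2]].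
  rewrite (fgM' _ nM'); apply: gap_slice => //.
    by move=> Hb; apply: n1; split.
  by apply/eqP => Ht; apply: n2; split.
Qed.

End convergence.

End parallel_hyperplanes.

(** * The approximating sequence *)

Section approximation.
Context {R : realType} (n : nat) (H : ohyp R n).

(** Independent of the exponent and of the function, so the same sequence serves both halves of the
    theorem. *)
Definition approximants (k : nat) : seq (ohyp R n) :=
  parallel H (centers (hoffset H) k).

Lemma size_approximants k : (0 < size (approximants k))%N.
Proof. by rewrite /approximants /parallel !size_map size_iota muln_gt0 expn_gt0. Qed.

Lemma cvg_approximants (p : R) (f : n.-tuple R -> R) : 1 <= p -> Lp_plus p f ->
  (fun k => Lp_dist_pow p (polar_comp (approximants k) f) (solynin H f))
    @ \oo --> 0%E.
Proof.
move=> p1 [f0 [[g1 mg1 [M [mM M0] fg1]] fint]].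
have [d [Z [nu [L]]]] := ex_line_coordinates (hnormal_unit H).
(* The Borel representative may be negative on [M]. The value 0 there makes it nonnegative and keeps
   its power below any majorant of that of [f]. *)
pose g x := if x \in M then 0 else g1 x.
have fg x : ~ M x -> f x = g x.
  move=> Mx; rewrite /g memNset//; apply: contrapT => fgx.
  by apply: Mx; exact: fg1.
have g0 x : 0 <= g x.
  have [Mx|Mx] := pselect (M x); last by rewrite -fg.
  by rewrite /g mem_set.
have mg : measurable_fun setT g.
  apply: measurable_fun_ifT => //.
  apply: (measurable_fun_bool true); rewrite setTI.
  by rewrite (_ : _ @^-1` _ = M)//; apply/seteqP; split => x /= => [/set_mem|/mem_set].
have [m mE] := @ex_lebn R n.
apply: (cvg_Lp_dist_pow L p1 f0 g0 mg mM M0 fg).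
move: fint => /ereal_inf_lt[_ [h [mh fh] <-]]; apply: le_lt_trans.
rewrite -mE; apply: ge0_le_integral => //.
- by move=> x _; rewrite lee_fin powR_ge0.
- apply/measurable_EFinP.
  exact: (@measurableT_comp _ _ _ _ _ _ (@powR R ^~ p)).
- move=> x _; apply: le_trans (fh x); rewrite lee_fin.
  have [Mx|Mx] := pselect (M x); last by rewrite -fg// ger0_norm.
  by rewrite /g mem_set// powR0 ?powR_ge0//; lra.
Qed.

(** The case [p = 1] for indicators, on which the function and set versions of both maps agree off
    H. *)
Lemma cvg_approximants_set (A : set (n.-tuple R)) : Lclass A ->
  (fun k => Lp_dist_pow 1
     (\1_(polar_set_comp (approximants k) A) : n.-tuple R -> R)
     (\1_(sol_set H A))) @ \oo --> 0%E.
Proof.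
move=> [[B mB [M [mM M0] AB]] Aoo].
have [d [Z [nu [L]]]] := ex_line_coordinates (hnormal_unit H).
have [m mE] := @ex_lebn R n.
have A1 : Lp_plus 1 (\1_A : n.-tuple R -> R).
  split => //; split.
    exists \1_B; first exact: measurable_indic.
    exists M => // x /= ABx; apply: AB.
    have [Ax|Ax] := pselect (A x); have [Bx|Bx] := pselect (B x).
    - by case: ABx; rewrite !indicE !mem_set.
    - by left.
    - by right.
    - by case: ABx; rewrite !indicE !memNset.
  move: Aoo => /ereal_inf_lt[_ [D [mD AD] <-] Doo].
  apply: le_lt_trans Doo; apply: (@le_trans _ _ (\int[m]_x (\1_D x)%:E)%E).
    rewrite -mE; apply: (@upint_le _ _ _ m _ _ set0) => //.
    - by apply/measurable_EFinP; exact: measurable_indic.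
    - move=> x _; rewrite lee_fin powRr1// ger0_norm// !indicE.
      by case: (boolP (x \in A)) => [/set_mem/AD/mem_set ->|].
  by rewrite integral_indic// setIT -mE.
have := cvg_approximants (lexx 1) A1; apply: squeeze_cvge; last exact: cvg_cst.
apply: nearW => k; rewrite /Lp_dist_pow -mE; apply/andP; split.
  by apply: upint_ge0 => x; rewrite lee_fin powR_ge0.
pose E := to_line L @^-1` ([set hoffset H] `*` setT).
have mE2 : measurable E.
  by apply: measurable_preimage; [exact: measurable_to_line|exact: measurableX].
have E0 : m E = 0%E.
  rewrite mE lebn_to_line; last exact: measurableX.
  have t0 : lebesgue_measure [set hoffset H] = 0%E by exact: lebesgue_measure_set1.
  rewrite product_measure1E//=.
  by apply: (etrans _ (mul0e (nu setT))); congr (_ * _)%E.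
apply: (upint_ae_le mE2 E0) => [x|x nE]; first by rewrite lee_fin powR_ge0.
rewrite polar_comp_indic solynin_indic//.
by apply/eqP => xt; apply: nE; split => //=; rewrite to_line1.
Qed.

End approximation.

Theorem theorem8p4 (R : realType) (n : nat) (H : ohyp R n) (p : R) :
  1 <= p ->
  (exists S : nat -> seq (ohyp R n),
     (forall k, (0 < size (S k))%N) /\
     forall f : n.-tuple R -> R, Lp_plus p f ->
       (fun k => Lp_dist_pow p (polar_comp (S k) f) (solynin H f))
         @ \oo --> 0%E)
  /\
  (exists S : nat -> seq (ohyp R n),
     (forall k, (0 < size (S k))%N) /\
     forall A : set (n.-tuple R), Lclass A ->
       (fun k => Lp_dist_pow 1
                   (\1_(polar_set_comp (S k) A) : n.-tuple R -> R)
                   (\1_(sol_set H A)))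
         @ \oo --> 0%E).
Proof.
move=> p1; split; exists (approximants H); split; try exact: size_approximants.
  by move=> f; exact: cvg_approximants.
exact: cvg_approximants_set.
Qed.
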